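(* Let $L$ be a holomorphic line bundle on $\Delta^*$ and let $h$ be a flat Hermitian metric on $L$. Then $$(L,h)\simeq\left(\mathcal{O}_{\Delta^*},\frac{|\cdot|^2}{|z|^{2c}}\right)$$ for some $c\in\mathbb{R}$.
   Context: $\Delta^*=\{z\in\mathbb{C}: 0<|z|<1\}$. A flat Hermitian metric is a smooth Hermitian metric whose Chern connection has zero curvature on $\Delta^*$. The symbol $\simeq$ denotes an isometric isomorphism of holomorphic line bundles on $\Delta^*$; the metric $|\cdot|^2/|z|^{2c}$ on $\mathcal{O}_{\Delta^*}$ gives a function $f$ the squared norm $|f|^2/|z|^{2c}$. *)

(* Defs.v *)
From Stdlib Require Import Reals Lra.
From Coquelicot Require Import Coquelicot.

Set Implicit Arguments.
Unset Strict Implicit.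

Local Open Scope R_scope.

Definition holomorphic_on (U : C -> Prop) (f : C -> C) : Prop :=
  forall z, U z -> @ex_derive C_AbsRing C_NormedModule f z.

(** [C^infinity] as a function of [x + i y].  [ex_diff_n g n x y] is a
    condition at one point; holding at all points of an open set, it says that
    [g] is of class [C^n] there. *)
Definition smooth_on (U : C -> Prop) (f : C -> C) : Prop :=
  forall (n : nat) (z : C), U z ->
    ex_diff_n (fun x y => Re (f (x, y))) n (Re z) (Im z) /\
    ex_diff_n (fun x y => Im (f (x, y))) n (Re z) (Im z).

Definition d_x (f : C -> C) (z : C) : C :=
  (Derive (fun t => Re (f (t, Im z))) (Re z),
   Derive (fun t => Im (f (t, Im z))) (Re z)).

Definition d_y (f : C -> C) (z : C) : C :=
  (Derive (fun t => Re (f (Re z, t))) (Im z),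
   Derive (fun t => Im (f (Re z, t))) (Im z)).

(** Wirtinger derivatives [d/dz] and [d/dzbar]. *)
Definition d_z (f : C -> C) (z : C) : C := ((d_x f z - Ci * d_y f z) / 2)%C.
Definition d_zbar (f : C -> C) (z : C) : C := ((d_x f z + Ci * d_y f z) / 2)%C.

Definition linear_map (V W : ModuleSpace C_Ring) (f : V -> W) : Prop :=
  (forall u v, f (plus u v) = plus (f u) (f v)) /\
  (forall (a : C) v, f (scal a v) = scal a (f v)).

(** A holomorphic line bundle on the open set [X], given by its fibres and a
    holomorphic atlas of local trivializations.  [fiber], [triv] and [trivV]
    are total functions of the base point for convenience; only their values
    over [X], resp. over the open set [dom i], are meaningful. *)
Record line_bundle (X : C -> Prop) := LineBundle {
  fiber : C -> ModuleSpace C_Ring;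
  chart : Type;
  dom : chart -> C -> Prop;
  triv : chart -> forall z, fiber z -> C;
  trivV : chart -> forall z, C -> fiber z;
  dom_open : forall i, open (dom i);
  dom_sub : forall i z, dom i z -> X z;
  dom_cover : forall z, X z -> exists i, dom i z;
  triv_linear : forall i z, dom i z ->
    @linear_map (fiber z) C_ModuleSpace (@triv i z);
  trivK : forall i z, dom i z -> forall v, trivV i z (triv i v) = v;
  trivVK : forall i z, dom i z -> forall a, triv i (trivV i z a) = a;
  transition_holomorphic : forall i j,
    holomorphic_on (fun z => dom i z /\ dom j z)
      (fun z => triv i (trivV j z 1%C))
}.

Arguments triv {X} _ _ {z} _.

Definition section (X : C -> Prop) (L : line_bundle X) : Type :=
  forall z : C, fiber L z.

Definition frame (X : C -> Prop) (L : line_bundle X) (i : chart L) : section L :=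
  fun z => trivV i z 1%C.

(** Since the transition functions are holomorphic, hence smooth, smoothness
    near a point does not depend on the trivialization used there. *)
Definition smooth_section (X : C -> Prop) (L : line_bundle X)
    (U : C -> Prop) (s : section L) : Prop :=
  forall z, U z -> exists i : chart L,
    dom i z /\ smooth_on (fun w => U w /\ dom i w) (fun w => triv L i (s w)).

Definition bundle_form (X : C -> Prop) (L : line_bundle X) : Type :=
  forall z : C, fiber L z -> fiber L z -> C.

(** The inner product is linear in its first argument. *)
Record hermitian_metric (X : C -> Prop) (L : line_bundle X)
    (h : bundle_form L) : Prop := {
  herm_plus : forall z, X z -> forall u v w : fiber L z,
    h z (plus u v) w = (h z u w + h z v w)%C;
  herm_scal : forall z, X z -> forall (a : C) (u w : fiber L z),
    h z (scal a u) w = (a * h z u w)%C;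
  herm_conj : forall z, X z -> forall u v : fiber L z,
    h z v u = Cconj (h z u v);
  herm_pos : forall z, X z -> forall u : fiber L z,
    u <> zero -> 0 < Re (h z u u);
  herm_smooth : forall i : chart L,
    smooth_on (dom i) (fun z => h z (frame i z) (frame i z))
}.

(** A connection [D = Dz (x) dz + Dzb (x) dzbar] on smooth local sections.
    [Dz] and [Dzb] act on total functions [section L], but only the values at
    points near which the section is smooth are constrained;
    [conn_z_local] and [conn_zb_local] say that these are determined by the
    germ of the section, so that [D] is a map of sheaves. *)
Record is_connection (X : C -> Prop) (L : line_bundle X)
    (Dz Dzb : section L -> section L) : Prop := {
  conn_z_local : forall (U : C -> Prop) (s t : section L), open U ->
    (forall z, U z -> X z) -> smooth_section U s -> smooth_section U t ->
    (forall z, U z -> s z = t z) -> forall z, U z -> Dz s z = Dz t z;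
  conn_zb_local : forall (U : C -> Prop) (s t : section L), open U ->
    (forall z, U z -> X z) -> smooth_section U s -> smooth_section U t ->
    (forall z, U z -> s z = t z) -> forall z, U z -> Dzb s z = Dzb t z;
  conn_smooth : forall (U : C -> Prop) (s : section L), open U ->
    (forall z, U z -> X z) -> smooth_section U s ->
    smooth_section U (Dz s) /\ smooth_section U (Dzb s);
  conn_plus : forall (U : C -> Prop) (s t : section L), open U ->
    (forall z, U z -> X z) -> smooth_section U s -> smooth_section U t ->
    forall z, U z ->
      Dz (fun w => plus (s w) (t w)) z = plus (Dz s z) (Dz t z) /\
      Dzb (fun w => plus (s w) (t w)) z = plus (Dzb s z) (Dzb t z);
  conn_leibniz : forall (U : C -> Prop) (f : C -> C) (s : section L), open U ->
    (forall z, U z -> X z) -> smooth_on U f -> smooth_section U s ->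
    forall z, U z ->
      Dz (fun w => scal (f w) (s w)) z
        = plus (scal (d_z f z) (s z)) (scal (f z) (Dz s z)) /\
      Dzb (fun w => scal (f w) (s w)) z
        = plus (scal (d_zbar f z) (s z)) (scal (f z) (Dzb s z))
}.

(** The Chern connection of [(L, h)]: the unique connection whose [(0,1)]-part
    is the Cauchy-Riemann operator of [L] and for which [h] is parallel, i.e.
    [d (h (s, t)) = h (D s, t) + h (s, D t)], written out in [dz] and [dzbar]
    (whence the exchange of [Dz] and [Dzb] in the antilinear argument). *)
Record is_chern_connection (X : C -> Prop) (L : line_bundle X)
    (h : bundle_form L) (Dz Dzb : section L -> section L) : Prop := {
  chern_connection : is_connection Dz Dzb;
  chern_dbar : forall (U : C -> Prop) (s : section L), open U ->
    (forall z, U z -> X z) -> smooth_section U s ->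
    forall (i : chart L) z, U z -> dom i z ->
      triv L i (Dzb s z) = d_zbar (fun w => triv L i (s w)) z;
  chern_metric : forall (U : C -> Prop) (s t : section L), open U ->
    (forall z, U z -> X z) -> smooth_section U s -> smooth_section U t ->
    forall z, U z ->
      d_z (fun w => h w (s w) (t w)) z
        = (h z (Dz s z) (t z) + h z (s z) (Dzb t z))%C /\
      d_zbar (fun w => h w (s w) (t w)) z
        = (h z (Dzb s z) (t z) + h z (s z) (Dz t z))%C
}.

(** The curvature is [D^2 s = (Dz (Dzb s) - Dzb (Dz s)) dz /\ dzbar]. *)
Definition zero_curvature (X : C -> Prop) (L : line_bundle X)
    (Dz Dzb : section L -> section L) : Prop :=
  forall (U : C -> Prop) (s : section L), open U ->
    (forall z, U z -> X z) -> smooth_section U s ->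
    forall z, U z -> minus (Dz (Dzb s) z) (Dzb (Dz s) z) = zero.

Definition flat_hermitian_metric (X : C -> Prop) (L : line_bundle X)
    (h : bundle_form L) : Prop :=
  hermitian_metric h /\
  exists Dz Dzb, is_chern_connection h Dz Dzb /\ zero_curvature Dz Dzb.

Record bundle_morphism (X : C -> Prop) (L M : line_bundle X)
    (phi : forall z, fiber L z -> fiber M z) : Prop := {
  mor_linear : forall z, X z -> linear_map (phi z);
  mor_holomorphic : forall (i : chart L) (j : chart M),
    holomorphic_on (fun z => dom i z /\ dom j z)
      (fun z => triv M j (phi z (frame i z)))
}.

Definition isometric_isomorphic (X : C -> Prop) (L M : line_bundle X)
    (h : bundle_form L) (k : bundle_form M) : Prop :=
  exists (phi : forall z, fiber L z -> fiber M z)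
         (psi : forall z, fiber M z -> fiber L z),
    bundle_morphism phi /\ bundle_morphism psi /\
    (forall z, X z -> forall u, psi z (phi z u) = u) /\
    (forall z, X z -> forall v, phi z (psi z v) = v) /\
    (forall z, X z -> forall u v, k z (phi z u) (phi z v) = h z u v).

Definition trivial_bundle (X : C -> Prop) (hX : open X) : line_bundle X.
Proof.
refine (@LineBundle X (fun _ => C_ModuleSpace) unit (fun _ => X)
  (fun _ _ v => v) (fun _ _ a => a) (fun _ => hX) _ _ _ _ _ _).
- auto.
- intros z hz; exists tt; exact hz.
- intros; split; reflexivity.
- reflexivity.
- reflexivity.
- intros i j z _; apply ex_derive_const.
Defined.

Definition punctured_disc (z : C) : Prop := 0 < Cmod z < 1.

Lemma punctured_disc_open : open punctured_disc.
Proof.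
assert (hc : forall z : C, continuous Cmod z).
{ intros z; apply (@filterlim_norm C_AbsRing C_NormedModule). }
apply open_and.
- apply (@open_comp C_UniformSpace R_UniformSpace Cmod (fun r => 0 < r)).
  + intros z _; apply hc.
  + apply open_gt.
- apply (@open_comp C_UniformSpace R_UniformSpace Cmod (fun r => r < 1)).
  + intros z _; apply hc.
  + apply open_lt.
Qed.

Definition trivial_punctured : line_bundle punctured_disc :=
  trivial_bundle punctured_disc_open.

(** The metric [|.|^2 / |z|^(2c)], polarized. *)
Definition model_metric (c : R) : bundle_form trivial_punctured :=
  fun z (f g : C) => (f * Cconj g / RtoC (Rpower (Cmod z) (2 * c)))%C.

(* Main.v *)
(** Curvature zero says that [ddbar log h(e, e) = 0] for a holomorphic frame
    [e], so locally [log h(e, e)] is the real part of a holomorphic function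
    [G], and [exp (- G / 2) e] is a holomorphic section of norm 1.  The ratio of
    two such sections is holomorphic of modulus 1, hence locally constant, so
    unit sections can be continued uniquely along segments and exist on each of
    the half discs [Re (z (-i)^k) > 0], [k = 0..3].  Going once around the origin
    multiplies the section by some [exp (i t)], and multiplying it by a branch
    of [z^a], [2 PI a = - t], gives a global holomorphic frame of squared norm
    [|z|^(2a)], i.e. an isometry with the model for [c = - a]. *)

Require Import Defs.
From Stdlib Require Import Reals Lra Classical ClassicalEpsilon.
From Coquelicot Require Import Coquelicot.

Set Implicit Arguments.
Unset Strict Implicit.
Local Open Scope R_scope.

(** * Complex derivatives *)

(** Convexity stands in for connectedness throughout: a holomorphic function of modulus 1 on a
    convex open set is constant because its derivative vanishes along segments. This dictates the
    half discs. Each is convex, consecutive ones meet in a convex quarter disc, and opposite ones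
    are disjoint, so four comparisons remain and the whole monodromy is pushed into the last one.
    The monodromy is a ratio of unit sections, so it has modulus 1; this is why [t], and with it the
    exponent, is real. As [t] matters only modulo [2 PI], the exponent matters only modulo integers:
    multiplication by [z] is an isometry from the model for [c] to the model for [c + 1]. Holomorphy
    of explicit functions comes from the Cauchy-Riemann equations with continuous partials, and the
    only integration is that of a closed form on a square. *)

Notation is_Cderive := (@is_derive C_AbsRing C_NormedModule).
Notation ex_Cderive := (@ex_derive C_AbsRing C_NormedModule).

(** The product and chain rules see [C] as a module over itself, the definitions here use
    [C_NormedModule]. Operations and norm agree, so every field transfers unchanged. *)
Lemma is_Cderive_absring (f : C -> C) (z l : C) :
  is_Cderive f z l <->
  @is_derive C_AbsRing (AbsRing_NormedModule C_AbsRing) f z l.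
Proof.
split; intros [[h1 h2 h3] h4]; (split; [constructor|]);
  first [exact h1 | exact h2 | exact h3 | exact h4].
Qed.

Lemma locally_C_box (z : C) (P : C -> Prop) :
  @locally C_UniformSpace z P <->
  exists d : posreal, forall w : C,
    Rabs (Re w - Re z) < d -> Rabs (Im w - Im z) < d -> P w.
Proof.
split; intros [d hd]; exists d.
- intros w h1 h2; apply hd; split; assumption.
- intros w [h1 h2]; apply hd; assumption.
Qed.

Lemma locally_C_2d (z : C) (P : C -> Prop) :
  @locally C_UniformSpace z P <->
  locally_2d (fun x y => P (x, y)) (Re z) (Im z).
Proof.
rewrite locally_C_box; split; intros [d hd]; exists d.
- intros u v h1 h2; apply hd; assumption.
- intros [u v] h1 h2; apply hd; assumption.
Qed.

Lemma im_le_Cmod (c : C) : Rabs (Im c) <= Cmod c.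
Proof. eapply Rle_trans; [apply Rmax_r | apply Rmax_Cmod]. Qed.

Lemma Cmod_le_abs (c : C) : Cmod c <= Rabs (Re c) + Rabs (Im c).
Proof.
replace c with ((Re c, 0) + (0, Im c))%C at 1
  by (destruct c; unfold Cplus; simpl; f_equal; ring).
eapply Rle_trans; [apply Cmod_triangle|].
unfold Cmod; simpl.
apply Req_le; f_equal; rewrite <- sqrt_Rsqr_abs; f_equal; unfold Rsqr; ring.
Qed.

(** The derivative uses neighbourhoods given by the norm, the uniform structure of [C] uses squares;
    [locally_C] identifies the two filters. *)
Lemma is_Cderive_eps (f : C -> C) (z l : C) :
  is_Cderive f z l <->
  forall eps : posreal, @locally C_UniformSpace z (fun w =>
    Cmod (f w - f z - (w - z) * l)%C <= eps * Cmod (w - z)%C).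
Proof.
split.
- intros [_ h] eps.
  apply locally_C.
  exact (h z (fun P hP => hP) eps).
- intros h; split; [apply is_linear_scal_l|].
  intros x hx eps.
  rewrite <- (@is_filter_lim_locally_unique C_AbsRing (AbsRing_NormedModule C_AbsRing) z x hx).
  generalize (h eps); intros h'.
  apply -> locally_C in h'; exact h'.
Qed.

(** Multiplication by [l] is the real matrix with rows [(Re l, - Im l)] and [(Im l, Re l)]. The
    error is measured by [Cmod] on one side and by the maximum of the coordinates on the other;
    these norms differ by a factor at most 2, whence [eps / 2]. *)
Lemma is_Cderive_CR (f : C -> C) (z l : C) :
  is_Cderive f z l <->
  differentiable_pt_lim (fun x y => Re (f (x, y))) (Re z) (Im z) (Re l) (- Im l) /\
  differentiable_pt_lim (fun x y => Im (f (x, y))) (Re z) (Im z) (Im l) (Re l).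
Proof.
assert (ez : (Re z, Im z) = z) by (destruct z; reflexivity).
rewrite is_Cderive_eps; split.
- intros h.
  assert (h' : forall eps : posreal, locally_2d (fun u v =>
      Cmod (f (u, v) - f z - ((u, v) - z) * l)%C
        <= eps * Rmax (Rabs (u - Re z)) (Rabs (v - Im z))) (Re z) (Im z)).
  { intros eps.
    assert (he2 : 0 < eps / 2) by (generalize (cond_pos eps); lra).
    generalize (h (mkposreal _ he2)); rewrite locally_C_2d.
    apply locally_2d_impl, locally_2d_forall; intros u v huv; simpl in huv.
    eapply Rle_trans; [exact huv|].
    generalize (Cmod_2Rmax ((u, v) - z)%C); simpl; intros hm.
    assert (hs : sqrt 2 <= 2).
    { rewrite <- (sqrt_Rsqr 2) at 2 by lra. apply sqrt_le_1; unfold Rsqr; lra. }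
    change (fst z) with (Re z) in hm; change (snd z) with (Im z) in hm.
    replace (u - Re z) with (u + - Re z) by ring.
    replace (v - Im z) with (v + - Im z) by ring.
    set (m := Rmax (Rabs (u + - Re z)) (Rabs (v + - Im z))) in *.
    assert (hm0 : 0 <= m).
    { unfold m; eapply Rle_trans; [apply Rabs_pos | apply Rmax_l]. }
    apply Rle_trans with (eps / 2 * (2 * m)); [|apply Req_le; field].
    apply Rmult_le_compat_l; [lra|].
    eapply Rle_trans; [exact hm|]. apply Rmult_le_compat_r; assumption. }
  split; intros eps; generalize (h' eps);
    apply locally_2d_impl, locally_2d_forall; intros u v huv;
    (eapply Rle_trans; [|exact huv]).
  + eapply Rle_trans; [|apply re_le_Cmod].
    rewrite ez; apply Req_le; f_equal; simpl; unfold Re, Im; ring.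
  + eapply Rle_trans; [|apply im_le_Cmod].
    rewrite ez; apply Req_le; f_equal; simpl; unfold Re, Im; ring.
- intros [h1 h2] eps.
  assert (he2 : 0 < eps / 2) by (generalize (cond_pos eps); lra).
  generalize (locally_2d_and _ _ _ _ (h1 (mkposreal _ he2)) (h2 (mkposreal _ he2))).
  rewrite locally_C_2d; apply locally_2d_impl, locally_2d_forall.
  intros u v [k1 k2]; simpl in k1, k2.
  rewrite ez in k1, k2.
  eapply Rle_trans; [apply Cmod_le_abs|].
  assert (hm : Rmax (Rabs (u - Re z)) (Rabs (v - Im z)) <= Cmod ((u, v) - z)%C)
    by exact (Rmax_Cmod ((u, v) - z)%C).
  apply Rle_trans with (eps * Rmax (Rabs (u - Re z)) (Rabs (v - Im z)));
    [|apply Rmult_le_compat_l; [apply Rlt_le, cond_pos | exact hm]].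
  replace (Re (f (u, v) - f z - ((u, v) - z) * l)%C)
    with (Re (f (u, v)) - Re (f z) - (Re l * (u - Re z) + - Im l * (v - Im z)))
    by (simpl; unfold Re, Im; ring).
  replace (Im (f (u, v) - f z - ((u, v) - z) * l)%C)
    with (Im (f (u, v)) - Im (f z) - (Im l * (u - Re z) + Re l * (v - Im z)))
    by (simpl; unfold Re, Im; ring).
  lra.
Qed.

Lemma ex_Cderive_ext_loc (f g : C -> C) (z : C) :
  @locally C_UniformSpace z (fun w => f w = g w) ->
  ex_Cderive f z -> ex_Cderive g z.
Proof.
intros h [l hl]; exists l.
apply is_derive_ext_loc with (2 := hl), locally_C, h.
Qed.

Lemma ex_Cderive_mult (f g : C -> C) (z : C) :
  ex_Cderive f z -> ex_Cderive g z -> ex_Cderive (fun w => (f w * g w)%C) z.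
Proof.
intros [l hl] [m hm].
apply is_Cderive_absring in hl; apply is_Cderive_absring in hm.
eexists; apply is_Cderive_absring.
apply (is_derive_mult f g z l m hl hm Cmult_comm).
Qed.

Lemma ex_Cderive_comp (f g : C -> C) (z : C) :
  ex_Cderive f (g z) -> ex_Cderive g z -> ex_Cderive (fun w => f (g w)) z.
Proof.
intros [l hl] [m hm].
apply is_Cderive_absring in hm.
eexists; apply (is_derive_comp f g z l m hl hm).
Qed.

(** The partials [a], [- b], [b], [a] are the Cauchy-Riemann system for the derivative [a + i b];
    continuity of partials gives real differentiability. *)
Lemma ex_Cderive_of_partials (u v : R -> R -> R) (a b : R -> R -> R) (z : C) :
  locally_2d (fun x y =>
    (is_derive (fun t => u t y) x (a x y) /\
     is_derive (fun t => u x t) y (- b x y)) /\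
    (is_derive (fun t => v t y) x (b x y) /\
     is_derive (fun t => v x t) y (a x y)) /\
    continuity_2d_pt a x y /\ continuity_2d_pt b x y) (Re z) (Im z) ->
  ex_Cderive (fun w => (u (Re w) (Im w), v (Re w) (Im w))) z.
Proof.
intros h.
assert (hz := locally_2d_singleton _ _ _ h); simpl in hz.
destruct hz as ((_ & hu) & (_ & hv) & ca & cb).
exists (a (Re z) (Im z), b (Re z) (Im z)).
apply is_Cderive_CR; simpl; split;
  apply filterdiff_differentiable_pt_lim.
- apply (is_derive_filterdiff u _ _ a).
  + apply locally_2d_locally in h; revert h; apply filter_imp; intros p hp; apply hp.
  + exact hu.
  + apply continuity_2d_pt_filterlim, ca.
- apply (is_derive_filterdiff v _ _ b).
  + apply locally_2d_locally in h; revert h; apply filter_imp; intros p hp; apply hp.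
  + exact hv.
  + apply continuity_2d_pt_filterlim, cb.
Qed.

Ltac continuity_2d :=
  repeat first
    [ assumption
    | apply continuity_2d_pt_const
    | apply continuity_2d_pt_id1
    | apply continuity_2d_pt_id2
    | apply continuity_2d_pt_opp
    | apply continuity_2d_pt_plus
    | apply continuity_2d_pt_minus
    | apply continuity_2d_pt_mult
    | apply continuity_2d_pt_inv ].

(* [repeat split] would unfold [is_derive]. *)
Ltac split_CR := split; [split | split; [split | split]].

(** * Exponential, inverse and logarithm *)

Definition Cexp (z : C) : C := (exp (Re z) * cos (Im z), exp (Re z) * sin (Im z)).

Lemma ex_Cderive_Cexp (z : C) : ex_Cderive Cexp z.
Proof.
apply (@ex_Cderive_of_partials (fun x y => exp x * cos y) (fun x y => exp x * sin y)
  (fun x y => exp x * cos y) (fun x y => exp x * sin y)).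
apply locally_2d_forall; intros x y.
assert (forall f : R -> R, continuity f ->
  continuity_2d_pt (fun u v => exp u * f v) x y).
{ intros f hf; apply continuity_2d_pt_mult.
  - apply (continuity_1d_2d_pt_comp exp (fun u v => u));
      [apply derivable_continuous_pt, derivable_pt_exp | continuity_2d].
  - apply (continuity_1d_2d_pt_comp f (fun u v => v)); [apply hf | continuity_2d]. }
split_CR; try (auto_derive; [trivial|ring]).
- apply H, continuity_cos.
- apply H, continuity_sin.
Qed.

Lemma Cexp_plus (z w : C) : Cexp (z + w)%C = (Cexp z * Cexp w)%C.
Proof.
destruct z as [a b], w as [c d]; unfold Cexp, Cmult, Cplus; simpl.
rewrite exp_plus, cos_plus, sin_plus; f_equal; ring.
Qed.

Lemma Cmod_Cexp (z : C) : Cmod (Cexp z) = exp (Re z).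
Proof.
unfold Cmod, Cexp; simpl.
transitivity (sqrt (exp (Re z))²); [|apply sqrt_Rsqr, Rlt_le, exp_pos].
generalize (sin2_cos2 (Im z)); unfold Rsqr; intros h; f_equal.
transitivity (exp (Re z) * exp (Re z) * (sin (Im z) * sin (Im z) + cos (Im z) * cos (Im z)));
  [ring | rewrite h; ring].
Qed.

Lemma sum_sqr_neq0 (x y : R) : (x, y) <> RtoC 0 -> x * x + y * y <> 0.
Proof.
intros h e; apply h.
assert (x = 0) by nra; assert (y = 0) by nra; subst; reflexivity.
Qed.

Lemma C_neq0_locally (z : C) : z <> RtoC 0 ->
  locally_2d (fun x y => x * x + y * y <> 0) (Re z) (Im z).
Proof.
intros hz; apply (continuity_2d_pt_neq_0 (fun x y => x * x + y * y)).
- continuity_2d.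
- apply sum_sqr_neq0; destruct z; exact hz.
Qed.

Lemma ex_Cderive_inv (z : C) : z <> RtoC 0 -> ex_Cderive Cinv z.
Proof.
intros hz.
apply (@ex_Cderive_of_partials
  (fun x y => x / (x ^ 2 + y ^ 2)) (fun x y => - y / (x ^ 2 + y ^ 2))
  (* Real and imaginary parts of [- 1 / z^2 = - (conj z)^2 / |z|^4], written with products and
     inverses only, the form that [continuity_2d] handles. *)
  (fun x y => - (x * x - y * y) * (/ (x * x + y * y) * / (x * x + y * y)))
  (fun x y => 2 * x * y * (/ (x * x + y * y) * / (x * x + y * y)))).
generalize (C_neq0_locally hz).
apply locally_2d_impl, locally_2d_forall; intros x y h.
assert (x * (x * 1) + y * (y * 1) <> 0) by (rewrite !Rmult_1_r; exact h).
assert (x ^ 2 + y ^ 2 <> 0) by exact H.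
split_CR; try (auto_derive; [assumption | field; auto]);
  continuity_2d; exact h.
Qed.

Lemma ex_Cderive_div (f g : C -> C) (z : C) : g z <> RtoC 0 ->
  ex_Cderive f z -> ex_Cderive g z -> ex_Cderive (fun w => (f w / g w)%C) z.
Proof.
intros h hf hg; apply ex_Cderive_mult; [exact hf|].
apply ex_Cderive_comp; [apply ex_Cderive_inv, h | exact hg].
Qed.

(** The principal logarithm, on the half plane [Re z > 0]. *)
Definition Clog (z : C) : C :=
  (ln (Re z * Re z + Im z * Im z) / 2, atan (Im z / Re z)).

Lemma ex_Cderive_Clog (z : C) : 0 < Re z -> ex_Cderive Clog z.
Proof.
intros hz.
apply (@ex_Cderive_of_partials
  (fun x y => ln (x * x + y * y) / 2) (fun x y => atan (y / x))
  (fun x y => x * / (x * x + y * y)) (fun x y => - y * / (x * x + y * y))).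
assert (hl : locally_2d (fun x _ => 0 < x) (Re z) (Im z)).
{ exists (mkposreal _ hz); simpl; intros u v h _; apply Rabs_lt_between in h; lra. }
revert hl; apply locally_2d_impl, locally_2d_forall; intros x y h.
assert (0 < x * x + y * y) by nra.
assert (1 + (y / x)² <> 0) by (generalize (Rle_0_sqr (y / x)); lra).
assert (hat : forall t : R, is_derive atan t (/ (1 + t²))) by apply is_derive_atan.
assert (x <> 0) by lra.
assert (x * x + y * y <> 0) by lra.
split_CR; try (continuity_2d; lra).
- auto_derive; [assumption | field; lra].
- auto_derive; [assumption | field; lra].
- replace (- y * / (x * x + y * y)) with (- y / x ^ 2 * / (1 + (y / x)²)).
  + apply (is_derive_comp atan (fun t => y / t)); [apply hat|].
    auto_derive; [assumption | field; assumption].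
  + unfold Rsqr; field; repeat split; try assumption; lra.
- replace (x * / (x * x + y * y)) with (1 / x * / (1 + (y / x)²)).
  + apply (is_derive_comp atan (fun t => t / x)); [apply hat|].
    auto_derive; [trivial | field; assumption].
  + unfold Rsqr; field; repeat split; try assumption; lra.
Qed.

(** * Holomorphic functions of modulus 1 *)

Lemma is_derive_line (f : C -> C) (z d l : C) (t : R) :
  is_Cderive f (z + t * d)%C l ->
  is_derive (fun s : R => Re (f (z + s * d)%C)) t (Re (l * d)%C) /\
  is_derive (fun s : R => Im (f (z + s * d)%C)) t (Im (l * d)%C).
Proof.
rewrite is_Cderive_CR; intros [h1 h2].
assert (e : forall s : R, (z + s * d)%C = (Re z + s * Re d, Im z + s * Im d)).
{ intros s; unfold Cplus, Cmult; simpl; unfold Re, Im; f_equal; ring. }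
rewrite e in h1, h2; simpl in h1, h2.
assert (k1 : derivable_pt_lim (fun s => Re z + s * Re d) t (Re d)).
{ apply is_derive_Reals; auto_derive; [trivial|ring]. }
assert (k2 : derivable_pt_lim (fun s => Im z + s * Im d) t (Im d)).
{ apply is_derive_Reals; auto_derive; [trivial|ring]. }
split.
- apply is_derive_ext with (fun s => Re (f (Re z + s * Re d, Im z + s * Im d))).
  { intros s; rewrite e; reflexivity. }
  apply is_derive_Reals.
  replace (Re (l * d)%C) with (Re l * Re d + - Im l * Im d)
    by (simpl; unfold Re, Im; ring).
  apply (derivable_pt_lim_comp_2d (fun x y => Re (f (x, y)))); assumption.
- apply is_derive_ext with (fun s => Im (f (Re z + s * Re d, Im z + s * Im d))).
  { intros s; rewrite e; reflexivity. }
  apply is_derive_Reals.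
  replace (Im (l * d)%C) with (Im l * Re d + Re l * Im d)
    by (simpl; unfold Re, Im; ring).
  apply (derivable_pt_lim_comp_2d (fun x y => Im (f (x, y)))); assumption.
Qed.

Definition convex (V : C -> Prop) : Prop :=
  forall (z w : C) (t : R), V z -> V w -> 0 <= t <= 1 -> V (z + t * (w - z))%C.

Lemma Cmod1_sqr (c : C) : Cmod c = 1 -> Re c * Re c + Im c * Im c = 1.
Proof.
intros h; generalize (Cmod2_alt c); rewrite h; intros e; simpl in e; lra.
Qed.

(** Differentiating [|g|^2 = 1] in the direction [d] gives [Re (conj (g z) * l * d) = 0]. The
    directions [1] and [i] then force [conj (g z) * l = 0], and [g z] is not zero. *)
Lemma unimodular_derive_0 (g : C -> C) (z l : C) :
  @locally C_UniformSpace z (fun w => Cmod (g w) = 1) ->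
  is_Cderive g z l -> l = RtoC 0.
Proof.
intros hl hg.
assert (e0 : forall d : C, (z + RtoC 0 * d)%C = z).
{ intros d; unfold Cplus, Cmult, RtoC; destruct z; simpl; f_equal; ring. }
assert (key : forall d : C, Re (g z) * Re (l * d)%C + Im (g z) * Im (l * d)%C = 0).
{ intros d.
  assert (hd : is_Cderive g (z + RtoC 0 * d)%C l) by (rewrite e0; exact hg).
  destruct (is_derive_line hd) as [k1 k2].
  set (u := fun s : R => Re (g (z + s * d)%C)) in *.
  set (v := fun s : R => Im (g (z + s * d)%C)) in *.
  assert (k : is_derive (fun s => u s * u s + v s * v s) 0
    (Re (l * d)%C * u 0 + u 0 * Re (l * d)%C + (Im (l * d)%C * v 0 + v 0 * Im (l * d)%C))).
  { apply (is_derive_plus (fun s => u s * u s) (fun s => v s * v s)).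
    - apply (is_derive_mult u u); [exact k1|exact k1|exact Rmult_comm].
    - apply (is_derive_mult v v); [exact k2|exact k2|exact Rmult_comm]. }
  assert (k' : is_derive (fun s => u s * u s + v s * v s) 0 0).
  { apply is_derive_ext_loc with (fun _ => 1).
    2: apply (@is_derive_const R_AbsRing R_NormedModule).
    apply locally_C_box in hl; destruct hl as [r hr].
    assert (hp : 0 < Rabs (Re d) + Rabs (Im d) + 1)
      by (generalize (Rabs_pos (Re d)) (Rabs_pos (Im d)); lra).
    (* For [s] below this bound, [z + s d] stays in the square of radius [r]; the [+ 1] covers
       [d = 0]. *)
    assert (hq : 0 < r / (Rabs (Re d) + Rabs (Im d) + 1))
      by (apply Rdiv_lt_0_compat; [apply cond_pos | exact hp]).
    exists (mkposreal _ hq); intros s hs.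
    change R in (type of s).
    change (Rabs (s + - 0) < r / (Rabs (Re d) + Rabs (Im d) + 1)) in hs.
    replace (s + - 0) with s in hs by ring.
    assert (hs' : Rabs s * (Rabs (Re d) + Rabs (Im d) + 1) < r).
    { apply (Rmult_lt_compat_r _ _ _ hp) in hs; unfold Rdiv in hs.
      rewrite Rmult_assoc, Rinv_l, Rmult_1_r in hs; lra. }
    generalize (Rabs_pos s) (Rabs_pos (Re d)) (Rabs_pos (Im d)); intros.
    symmetry; apply Cmod1_sqr, hr.
    - replace (Re (z + s * d)%C - Re z) with (s * Re d) by (simpl; unfold Re, Im; ring).
      rewrite Rabs_mult; nra.
    - replace (Im (z + s * d)%C - Im z) with (s * Im d) by (simpl; unfold Re, Im; ring).
      rewrite Rabs_mult; nra. }
  assert (q := is_derive_unique _ _ _ k).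
  rewrite (is_derive_unique _ _ _ k') in q.
  unfold u, v in q; rewrite e0 in q.
  lra. }
generalize (Cmod1_sqr (locally_singleton _ _ hl)); intros h1.
generalize (key 1%C) (key Ci); simpl; intros q1 q2.
destruct l as [a b]; simpl in *; unfold Re, Im in *; simpl in *.
destruct (g z) as [p q]; simpl in *.
assert (a = 0) by nra. assert (b = 0) by nra. subst; reflexivity.
Qed.

Lemma unimodular_const (V : C -> Prop) (g : C -> C) :
  open V -> convex V -> holomorphic_on V g ->
  (forall z, V z -> Cmod (g z) = 1) ->
  forall z w, V z -> V w -> g z = g w.
Proof.
intros hV hc hg h1 z w hz hw.
assert (d0 : forall t : R, 0 <= t <= 1 ->
  is_derive (fun s : R => Re (g (z + s * (w - z))%C)) t 0 /\
  is_derive (fun s : R => Im (g (z + s * (w - z))%C)) t 0).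
{ intros t ht.
  assert (hVt := hc z w t hz hw ht).
  destruct (hg _ hVt) as [l hl].
  assert (l = RtoC 0).
  { apply unimodular_derive_0 with (2 := hl).
    generalize (hV _ hVt); apply filter_imp; exact h1. }
  subst l; generalize (is_derive_line hl); simpl; rewrite !Rmult_0_l, Rminus_0_r, Rplus_0_r.
  exact (fun h => h). }
assert (e0 : (z + RtoC 0 * (w - z))%C = z) by ring.
assert (e1 : (z + RtoC 1 * (w - z))%C = w) by ring.
assert (r0 := eq_is_derive (fun s : R => Re (g (z + s * (w - z))%C)) 0 1
  (fun t ht => proj1 (d0 t ht)) Rlt_0_1).
assert (i0 := eq_is_derive (fun s : R => Im (g (z + s * (w - z))%C)) 0 1
  (fun t ht => proj2 (d0 t ht)) Rlt_0_1).
cbv beta in r0, i0; rewrite e0, e1 in r0, i0.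
destruct (g z), (g w); simpl in *; subst; reflexivity.
Qed.

(** * Primitives of closed forms on a square *)

Lemma between_abs (a b s r : R) :
  Rabs (b - a) < r -> Rmin a b <= s <= Rmax a b -> Rabs (s - a) < r.
Proof.
intros h hs; apply Rabs_lt_between in h; apply Rabs_lt_between.
unfold Rmin, Rmax in hs; destruct (Rle_dec a b); lra.
Qed.

Lemma continuity_2d_pt_slice_y (f : R -> R -> R) (x y : R) :
  continuity_2d_pt f x y -> continuous (fun t => f x t) y.
Proof.
intros h P hP.
apply continuity_2d_pt_filterlim in h; specialize (h P hP).
apply (locally_2d_1d_const_x (fun a b => P (f a b))), locally_2d_locally; exact h.
Qed.

Lemma continuity_2d_pt_slice_x (f : R -> R -> R) (x y : R) :
  continuity_2d_pt f x y -> continuous (fun t => f t y) x.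
Proof.
intros h P hP.
apply continuity_2d_pt_filterlim in h; specialize (h P hP).
apply (locally_2d_1d_const_y (fun a b => P (f a b))), locally_2d_locally; exact h.
Qed.

Lemma locally_abs (a x r : R) : Rabs (x - a) < r ->
  locally x (fun t => Rabs (t - a) < r).
Proof.
intros h.
assert (hp : 0 < r - Rabs (x - a)) by lra.
exists (mkposreal _ hp); intros t ht.
change (Rabs (t - x) < r - Rabs (x - a)) in ht.
replace (t - a) with ((t - x) + (x - a)) by ring.
generalize (Rabs_triang (t - x) (x - a)); lra.
Qed.

(** The hypothesis on [B] is [A_x + B_y = 0]: the form [- B dx + A dy] is
    closed on the square, and [w] is a primitive of it. *)
Lemma closed_form_exact (A B : R -> R -> R) (x0 y0 r : R) :
  (forall x y, Rabs (x - x0) < r -> Rabs (y - y0) < r ->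
    continuity_2d_pt A x y /\ continuity_2d_pt B x y /\
    ex_derive (fun t => A t y) x /\
    continuity_2d_pt (fun u v => Derive (fun t => A t v) u) x y /\
    is_derive (fun t => B x t) y (- Derive (fun t => A t y) x)) ->
  exists w : R -> R -> R,
    forall x y, Rabs (x - x0) < r -> Rabs (y - y0) < r ->
      is_derive (fun t => w t y) x (- B x y) /\
      is_derive (fun t => w x t) y (A x y).
Proof.
intros h.
(* Integral of [- B dx + A dy] from the centre, horizontally to [(x, y0)] and then vertically to
   [(x, y)]. *)
exists (fun x y => RInt (fun t => A x t) y0 y - RInt (fun s => B s y0) x0 x).
intros x y hx hy.
assert (r0 : Rabs (y0 - y0) < r).
{ replace (y0 - y0) with 0 by ring; rewrite Rabs_R0.
  generalize (Rabs_pos (x - x0)); lra. }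
assert (iA : forall a b, Rabs (a - x0) < r -> Rabs (b - y0) < r ->
  ex_RInt (fun t => A a t) y0 b).
{ intros a b ha hb; apply (@ex_RInt_continuous R_CompleteNormedModule).
  intros s hs; apply continuity_2d_pt_slice_y, h; [exact ha|].
  apply between_abs with (2 := hs); exact hb. }
assert (iB : forall a, Rabs (a - x0) < r -> ex_RInt (fun s => B s y0) x0 a).
{ intros a ha; apply (@ex_RInt_continuous R_CompleteNormedModule).
  intros s hs; apply (@continuity_2d_pt_slice_x B), h; [|exact r0].
  apply between_abs with (2 := hs); exact ha. }
split.
(* Differentiation under the integral sign. Closedness turns the integral of [A_x] into
   [- (B x y - B x y0)], whose boundary term cancels the derivative of the horizontal part. *)
- replace (- B x y) with
    (minus (RInt (fun t => Derive (fun u => A u t) x) y0 y) (B x y0)).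
  + apply (@is_derive_minus R_AbsRing R_NormedModule).
    * apply is_derive_RInt_param.
      -- generalize (locally_abs hx); apply filter_imp; intros a ha s hs.
         apply h; [exact ha | apply between_abs with (2 := hs); exact hy].
      -- intros s hs; apply h; [exact hx | apply between_abs with (2 := hs); exact hy].
      -- generalize (locally_abs hx); apply filter_imp; intros a ha.
         apply iA; assumption.
    * apply (@is_derive_RInt R_NormedModule (fun s => B s y0)) with (a := x0).
      -- generalize (locally_abs hx); apply filter_imp; intros a ha.
         apply (@RInt_correct R_CompleteNormedModule), iB; exact ha.
      -- apply (@continuity_2d_pt_slice_x B), h; assumption.
  + replace (RInt (fun t => Derive (fun u => A u t) x) y0 y)
      with (- (B x y - B x y0)).
    { unfold minus, plus, opp; simpl; ring. }
    symmetry; apply is_RInt_unique.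
    replace (- (B x y - B x y0)) with (minus ((fun t => - B x t) y) ((fun t => - B x t) y0))
      by (unfold minus, plus, opp; simpl; ring).
    apply (@is_RInt_derive R_CompleteNormedModule (fun t => - B x t)).
    * intros s hs.
      rewrite <- (Ropp_involutive (Derive (fun u => A u s) x)).
      apply (@is_derive_opp R_AbsRing R_NormedModule), h;
        [exact hx | apply between_abs with (2 := hs); exact hy].
    * intros s hs.
      apply (@continuity_2d_pt_slice_y (fun u v => Derive (fun t => A t v) u) x s), h;
        [exact hx | apply between_abs with (2 := hs); exact hy].
- replace (A x y) with (minus (A x y) 0)
    by (unfold minus, plus, opp; simpl; ring).
  apply (@is_derive_minus R_AbsRing R_NormedModule);
    [|apply (@is_derive_const R_AbsRing R_NormedModule)].
  apply (@is_derive_RInt R_NormedModule) with (a := y0).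
  + generalize (locally_abs hy); apply filter_imp; intros b hb.
    apply (@RInt_correct R_CompleteNormedModule), iA; assumption.
  + apply (@continuity_2d_pt_slice_y A), h; assumption.
Qed.

(** * Holomorphic sections of unit norm *)

Lemma triv_scal X (L : line_bundle X) (i : chart L) z (a : C) (v : fiber L z) :
  dom i z -> triv L i (scal a v) = (a * triv L i v)%C.
Proof. intros hz; apply (triv_linear hz). Qed.

Lemma triv_inj X (L : line_bundle X) (i : chart L) z (u v : fiber L z) :
  dom i z -> triv L i u = triv L i v -> u = v.
Proof. intros hz e; rewrite <- (trivK hz u), e; apply trivK, hz. Qed.

Lemma triv_frame X (L : line_bundle X) (i : chart L) z :
  dom i z -> triv L i (frame i z) = 1%C.
Proof. intros hz; apply trivVK, hz. Qed.

Lemma frame_coord X (L : line_bundle X) (i : chart L) z (v : fiber L z) :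
  dom i z -> v = scal (triv L i v) (frame i z).
Proof.
intros hz; apply (triv_inj (i := i) hz).
rewrite triv_scal, triv_frame by exact hz; ring.
Qed.

Lemma herm_scal_r X (L : line_bundle X) (h : bundle_form L)
  (hh : hermitian_metric h) z (a : C) (u v : fiber L z) :
  X z -> h z u (scal a v) = (Cconj a * h z u v)%C.
Proof.
intros hz.
rewrite (herm_conj hh hz (scal a v) u), (herm_scal hh hz), Cmult_conj.
rewrite <- (herm_conj hh hz v u); reflexivity.
Qed.

Lemma scal_C_assoc (V : ModuleSpace C_Ring) (a b : C) (v : V) :
  scal a (scal b v) = scal (a * b)%C v.
Proof. apply (@scal_assoc C_Ring). Qed.

Lemma scal_C_one (V : ModuleSpace C_Ring) (v : V) : scal (RtoC 1) v = v.
Proof. apply (@scal_one C_Ring). Qed.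

Lemma scal_C_zero (V : ModuleSpace C_Ring) (v : V) : scal (RtoC 0) v = zero.
Proof. apply (@scal_zero_l C_Ring). Qed.

Lemma herm_zero_l X (L : line_bundle X) (h : bundle_form L)
  (hh : hermitian_metric h) z (u : fiber L z) :
  X z -> h z zero u = 0%C.
Proof. intros hz; rewrite <- (scal_C_zero u), (herm_scal hh hz); ring. Qed.

Lemma herm_zero_r X (L : line_bundle X) (h : bundle_form L)
  (hh : hermitian_metric h) z (u : fiber L z) :
  X z -> h z u zero = 0%C.
Proof.
intros hz; rewrite <- (scal_C_zero u), (herm_scal_r hh _ _ _ hz).
unfold Cconj, Cmult, RtoC; simpl; f_equal; ring.
Qed.

Lemma herm_neq0_triv X (L : line_bundle X) (h : bundle_form L)
  (hh : hermitian_metric h) (i : chart L) z (v : fiber L z) :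
  X z -> dom i z -> h z v v <> RtoC 0 -> triv L i v <> RtoC 0.
Proof.
intros hX hz hv e; apply hv.
rewrite (frame_coord v hz), e, scal_C_zero; apply (herm_zero_l hh _ hX).
Qed.

(** In rank one [u] is a multiple of [v], and both sides compute the factor. The left side is
    independent of the chart; the right side shows that it is holomorphic when [u] and [v] vary
    holomorphically. *)
Lemma herm_ratio X (L : line_bundle X) (h : bundle_form L)
  (hh : hermitian_metric h) (i : chart L) z (u v : fiber L z) :
  X z -> dom i z -> h z v v <> RtoC 0 ->
  (h z u v / h z v v = triv L i u / triv L i v)%C.
Proof.
intros hX hz hv.
assert (ht := herm_neq0_triv hh hX hz hv).
assert (e : u = scal (triv L i u / triv L i v)%C v).
{ apply (triv_inj (i := i) hz); rewrite triv_scal by exact hz; field; exact ht. }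
rewrite e at 1; rewrite (herm_scal hh hX); field; split; assumption.
Qed.

Lemma herm_coord X (L : line_bundle X) (h : bundle_form L)
  (hh : hermitian_metric h) z (u v : fiber L z) :
  X z -> h z v v <> RtoC 0 -> u = scal (h z u v / h z v v)%C v.
Proof.
intros hX hv.
destruct (dom_cover L hX) as [i hi].
apply (triv_inj (i := i) hi).
rewrite triv_scal, (herm_ratio hh u hX hi hv) by exact hi.
field; apply (herm_neq0_triv hh hX hi hv).
Qed.

Definition holomorphic_section X (L : line_bundle X) (V : C -> Prop)
    (s : section L) : Prop :=
  forall i : chart L,
    holomorphic_on (fun z => V z /\ dom i z) (fun z => triv L i (s z)).

(** The coordinate in any other chart differs by a transition function, which is holomorphic. *)
Lemma holomorphic_section_of_chart X (L : line_bundle X) (V : C -> Prop)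
  (s : section L) :
  (forall z, V z -> exists i : chart L, dom i z /\
     ex_Cderive (fun w => triv L i (s w)) z) ->
  holomorphic_section V s.
Proof.
intros hs j z [hV hj].
destruct (hs z hV) as (i & hi & di).
apply ex_Cderive_ext_loc with
  (fun w => (triv L i (s w) * triv L j (trivV i w 1%C))%C).
- generalize (filter_and _ _ (dom_open hi) (dom_open hj)).
  apply filter_imp; intros w [wi wj].
  rewrite <- triv_scal by exact wj.
  f_equal; symmetry; apply frame_coord, wi.
- apply ex_Cderive_mult; [exact di|].
  apply (transition_holomorphic (i := j) (j := i)); split; assumption.
Qed.

Definition unit_section X (L : line_bundle X) (h : bundle_form L)
    (V : C -> Prop) (s : section L) : Prop :=
  holomorphic_section V s /\ forall z, V z -> h z (s z) (s z) = RtoC 1.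

Lemma holomorphic_section_subset X (L : line_bundle X)
  (V W : C -> Prop) (s : section L) :
  (forall z, W z -> V z) -> holomorphic_section V s -> holomorphic_section W s.
Proof. intros hW hs i z [h1 h2]; apply hs; split; auto. Qed.

Lemma unit_section_subset X (L : line_bundle X) (h : bundle_form L)
  (V W : C -> Prop) (s : section L) :
  (forall z, W z -> V z) -> unit_section h V s -> unit_section h W s.
Proof.
intros hW [hs h1]; split; [apply holomorphic_section_subset with V; auto | auto].
Qed.

Lemma holomorphic_section_scal X (L : line_bundle X) (V : C -> Prop)
  (f : C -> C) (s : section L) :
  holomorphic_on V f -> holomorphic_section V s ->
  holomorphic_section V (fun z => scal (f z) (s z)).
Proof.
intros hf hs i z [hV hi].
apply ex_Cderive_ext_loc with (fun w => (f w * triv L i (s w))%C).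
- generalize (dom_open hi); apply filter_imp; intros w wi.
  symmetry; apply triv_scal, wi.
- apply ex_Cderive_mult; [apply hf, hV | apply hs; split; assumption].
Qed.

Lemma Cmult_conj_unit (c : C) : Cmod c = 1 -> (c * Cconj c = 1)%C.
Proof. intros hc; rewrite <- Cmod2_conj, hc; unfold RtoC; simpl; f_equal; ring. Qed.

Lemma unit_section_scal X (L : line_bundle X) (h : bundle_form L)
  (hh : hermitian_metric h) (V : C -> Prop) (hV : forall z, V z -> X z)
  (c : C) (s : section L) : Cmod c = 1 ->
  unit_section h V s -> unit_section h V (fun z => scal c (s z)).
Proof.
intros hc [hs h1]; split.
- apply (@holomorphic_section_scal X L V (fun _ => c)); [|exact hs].
  intros z _; apply ex_derive_const.
- intros z hz; rewrite (herm_scal hh (hV z hz)), (herm_scal_r hh _ _ _ (hV z hz)), h1 by exact hz.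
  rewrite Cmult_1_r; apply Cmult_conj_unit, hc.
Qed.

Lemma RtoC_1_neq_0 : RtoC 1 <> RtoC 0.
Proof. intros e; apply RtoC_inj in e; lra. Qed.

(* The ratio [h (t, s)] of two unit holomorphic sections is holomorphic of
   modulus 1, hence constant on connected sets. *)
Lemma unit_section_unique X (L : line_bundle X) (h : bundle_form L)
  (hh : hermitian_metric h) (V : C -> Prop) (s t : section L) :
  open V -> convex V -> (forall z, V z -> X z) ->
  unit_section h V s -> unit_section h V t ->
  exists c : C, Cmod c = 1 /\ forall z, V z -> t z = scal c (s z).
Proof.
intros oV cV sV [hs s1] [ht t1].
assert (n0 : forall z, V z -> h z (s z) (s z) <> RtoC 0).
{ intros z hz; rewrite s1 by exact hz; apply RtoC_1_neq_0. }
set (g := fun z => h z (t z) (s z)).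
assert (tg : forall z, V z -> t z = scal (g z) (s z)).
{ intros z hz; rewrite (herm_coord hh (t z) (sV z hz) (n0 z hz)) at 1.
  f_equal; unfold g; rewrite s1 by exact hz; field. }
assert (g1 : forall z, V z -> Cmod (g z) = 1).
{ intros z hz.
  assert (e := t1 z hz).
  rewrite (tg z hz), (herm_scal hh (sV z hz)), (herm_scal_r hh _ _ _ (sV z hz)), s1 in e by exact hz.
  rewrite Cmult_1_r, <- Cmod2_conj in e.
  apply RtoC_inj in e.
  generalize (Cmod_ge_0 (g z)); intros; nra. }
assert (hg : holomorphic_on V g).
{ intros z hz.
  destruct (dom_cover L (sV z hz)) as [i hi].
  apply ex_Cderive_ext_loc with (fun w => triv L i (t w) / triv L i (s w))%C.
  - generalize (filter_and _ _ (oV z hz) (dom_open hi)).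
    apply filter_imp; intros w [wV wi].
    rewrite <- (herm_ratio hh (t w) (sV w wV) wi (n0 w wV)).
    unfold g; rewrite s1 by exact wV; field.
  - apply ex_Cderive_div.
    + apply (herm_neq0_triv hh (sV z hz) hi (n0 z hz)).
    + apply ht; split; assumption.
    + apply hs; split; assumption. }
(* The constant is the value of [g] at some point; if [V] is empty, any unimodular number will
   do. *)
destruct (classic (exists p, V p)) as [[p hp]|hne].
- exists (g p); split; [apply g1, hp|].
  intros z hz; rewrite (tg z hz); f_equal.
  apply (unimodular_const oV cV hg g1); assumption.
- exists 1%C; split; [apply Cmod_1|].
  intros z hz; exfalso; apply hne; exists z; exact hz.
Qed.

Lemma unit_section_eq X (L : line_bundle X) (h : bundle_form L)
  (hh : hermitian_metric h) (V : C -> Prop) (s t : section L) (p : C) :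
  open V -> convex V -> (forall z, V z -> X z) ->
  unit_section h V s -> unit_section h V t ->
  V p -> s p = t p -> forall z, V z -> s z = t z.
Proof.
intros oV cV sV hs ht hp e z hz.
destruct (unit_section_unique hh oV cV sV hs ht) as (c & hc & hst).
assert (e1 : h p (t p) (s p) = RtoC 1) by (rewrite <- e; apply hs, hp).
rewrite (hst p hp), (herm_scal hh (sV p hp)), (proj2 hs) in e1 by exact hp.
rewrite Cmult_1_r in e1; subst c.
rewrite (hst z hz), scal_C_one; reflexivity.
Qed.

(** * Smoothness of constants and locality of Wirtinger derivatives *)

Lemma ex_diff_n_const (c : R) (f : R -> R -> R) (n : nat) (x y : R) :
  (forall u v, f u v = c) -> ex_diff_n f n x y.
Proof.
revert c f x y; induction n as [|n IH]; intros c f x y hf.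
- split; [|trivial].
  apply continuity_2d_pt_ext with (fun _ _ => c); [auto | apply continuity_2d_pt_const].
- split.
  + apply continuity_2d_pt_ext with (fun _ _ => c); [auto | apply continuity_2d_pt_const].
  + split; [|split; [|split]].
    * apply ex_derive_ext with (fun _ => c); [auto | apply ex_derive_const].
    * apply ex_derive_ext with (fun _ => c); [auto | apply ex_derive_const].
    * apply IH with 0; intros u v.
      rewrite (Derive_ext _ (fun _ => c)) by auto; apply Derive_const.
    * apply IH with 0; intros u v.
      rewrite (Derive_ext _ (fun _ => c)) by auto; apply Derive_const.
Qed.

Lemma smooth_on_const (U : C -> Prop) (f : C -> C) (c : C) :
  open U -> (forall z, U z -> f z = c) -> smooth_on U f.
Proof.
intros oU hf n z hz.
assert (hl : locally_2d (fun x y => f (x, y) = c) (Re z) (Im z)).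
{ apply (proj1 (@locally_C_2d z (fun w => f w = c))); generalize (oU z hz); apply filter_imp; exact hf. }
split.
- apply ex_diff_n_ext_loc with (fun _ _ => Re c).
  + revert hl; apply locally_2d_impl, locally_2d_forall; intros u v e; rewrite e; reflexivity.
  + apply ex_diff_n_const with (Re c); auto.
- apply ex_diff_n_ext_loc with (fun _ _ => Im c).
  + revert hl; apply locally_2d_impl, locally_2d_forall; intros u v e; rewrite e; reflexivity.
  + apply ex_diff_n_const with (Im c); auto.
Qed.

Lemma d_zbar_ext_loc (f g : C -> C) (z : C) :
  @locally C_UniformSpace z (fun w => f w = g w) -> d_zbar f z = d_zbar g z.
Proof.
rewrite locally_C_2d; intros hl.
assert (hx := locally_2d_1d_const_y _ _ _ hl).
assert (hy := locally_2d_1d_const_x _ _ _ hl).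
cbv beta in hx, hy.
unfold d_zbar, d_x, d_y.
rewrite (Derive_ext_loc (fun t => Re (f (t, Im z))) (fun t => Re (g (t, Im z)))),
  (Derive_ext_loc (fun t => Im (f (t, Im z))) (fun t => Im (g (t, Im z)))),
  (Derive_ext_loc (fun t => Re (f (Re z, t))) (fun t => Re (g (Re z, t)))),
  (Derive_ext_loc (fun t => Im (f (Re z, t))) (fun t => Im (g (Re z, t))));
  solve [ reflexivity
        | revert hx; apply filter_imp; intros t e;
            solve [exact (f_equal Re e) | exact (f_equal Im e)]
        | revert hy; apply filter_imp; intros t e;
            solve [exact (f_equal Re e) | exact (f_equal Im e)] ].
Qed.

Lemma d_zbar_const (c z : C) : d_zbar (fun _ => c) z = 0%C.
Proof.
unfold d_zbar, d_x, d_y; rewrite !Derive_const.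
unfold Cdiv, Cmult, Cplus; simpl; unfold RtoC; f_equal; ring.
Qed.

Lemma d_z_const (c z : C) : d_z (fun _ => c) z = 0%C.
Proof.
unfold d_z, d_x, d_y; rewrite !Derive_const.
unfold Cdiv, Cminus, Copp, Cmult, Cplus; simpl; unfold RtoC; f_equal; ring.
Qed.

(** * Local unit sections from vanishing curvature *)

Lemma frame_neq0 X (L : line_bundle X) (i : chart L) z :
  dom i z -> frame i z <> zero.
Proof.
intros hz e; apply RtoC_1_neq_0.
rewrite <- (triv_frame hz), e, <- (scal_C_zero (frame i z)), triv_scal by exact hz.
ring.
Qed.

Lemma frame_norm_pos X (L : line_bundle X) (h : bundle_form L)
  (hh : hermitian_metric h) (i : chart L) z : dom i z ->
  0 < Re (h z (frame i z) (frame i z)) /\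
  h z (frame i z) (frame i z) = RtoC (Re (h z (frame i z) (frame i z))).
Proof.
intros hz; split; [apply (herm_pos hh (dom_sub hz)), frame_neq0, hz|].
generalize (herm_conj hh (dom_sub hz) (frame i z) (frame i z)).
destruct (h z (frame i z) (frame i z)) as [a b]; unfold Cconj, RtoC; simpl.
intros e; injection e; intros; f_equal; lra.
Qed.

Lemma smooth_section_frame X (L : line_bundle X) (i : chart L) :
  smooth_section (dom i) (frame i).
Proof.
intros z hz; exists i; split; [exact hz|].
apply smooth_on_const with (RtoC 1).
- apply open_and; apply dom_open.
- intros w [_ hw]; apply triv_frame, hw.
Qed.

(* In the frame [e] of a chart the connection form is [d_z h(e,e) / h(e,e)],
   and the curvature is its [d_zbar]-derivative. *)
Lemma flat_connection_form X (L : line_bundle X) (h : bundle_form L)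
  (hf : flat_hermitian_metric h) (i : chart L) :
  let N := fun w => h w (frame i w) (frame i w) in
  forall z, dom i z -> d_zbar (fun w => d_z N w / N w)%C z = 0%C.
Proof.
destruct hf as (hh & Dz & Dzb & hc & hflat); intros N z hz.
pose (e := frame i : section L).
(* The zero section, written as [0 * e] so that the Leibniz rule computes [Dz o]. [Dzb e] vanishes
   only over [dom i], so [conn_z_local] is what allows replacing it by [o] under [Dz]. *)
pose (o := (fun w => scal (RtoC 0) (e w)) : section L).
assert (oi := @dom_open _ _ i); assert (si := @dom_sub _ _ i).
assert (se : smooth_section (dom i) e) by apply smooth_section_frame.
assert (so : smooth_section (dom i) o).
{ intros w hw; exists i; split; [exact hw|].
  apply smooth_on_const with (RtoC 0); [apply open_and; exact oi|].
  intros v [_ hv]; unfold o; rewrite triv_scal by exact hv; ring. }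
assert (cn := chern_connection hc).
assert (zb0 : forall w, dom i w -> Dzb e w = zero).
{ intros w hw; apply (triv_inj (i := i) hw).
  rewrite (chern_dbar hc oi si se hw hw), <- (scal_C_zero (e w)), triv_scal by exact hw.
  rewrite (@d_zbar_ext_loc _ (fun _ => RtoC 1)), d_zbar_const; [ring|].
  generalize (oi w hw); apply filter_imp; intros v hv; apply triv_frame, hv. }
assert (DzDzb : Dz (Dzb e) z = zero).
{ rewrite (conn_z_local cn oi si (proj2 (conn_smooth cn oi si se)) so) by
    (try exact hz; intros w hw; rewrite zb0 by exact hw; symmetry; apply scal_C_zero).
  unfold o.
  destruct (conn_leibniz cn oi si (f := fun _ => RtoC 0)
    (smooth_on_const (f := fun _ => RtoC 0) oi (fun _ _ => eq_refl)) se hz) as [k _].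
  rewrite k, d_z_const, !scal_C_zero; apply (@plus_zero_l). }
assert (DzbDz : Dzb (Dz e) z = zero).
{ generalize (hflat _ _ oi si se z hz); rewrite DzDzb; unfold minus.
  rewrite plus_zero_l; intros k.
  rewrite <- (opp_opp (Dzb (Dz e) z)), k; apply (@opp_zero (fiber L z)). }
assert (th : forall w, dom i w -> triv L i (Dz e w) = (d_z N w / N w)%C).
{ intros w hw.
  (* Since [Dzb e = 0], compatibility with the metric reduces to [d_z N = h (Dz e, e)]. *)
  destruct (chern_metric hc oi si se se hw) as [k _].
  change (d_z N w = (h w (Dz e w) (e w) + h w (e w) (Dzb e w))%C) in k.
  rewrite zb0, (herm_zero_r hh _ (si w hw)), Cplus_0_r in k by exact hw.
  rewrite k.
  destruct (frame_norm_pos hh hw) as [p q].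
  assert (n0 : N w <> RtoC 0).
  { unfold N; rewrite q; intros ee; apply RtoC_inj in ee; lra. }
  transitivity (h w (Dz e w) (frame i w) / h w (frame i w) (frame i w))%C;
    [|reflexivity].
  rewrite (herm_ratio hh (Dz e w) (si w hw) hw n0), triv_frame by exact hw.
  field. }
rewrite <- (@d_zbar_ext_loc (fun w => triv L i (Dz e w))).
- rewrite <- (chern_dbar hc oi si (proj1 (conn_smooth cn oi si se)) hz hz), DzbDz.
  rewrite <- (scal_C_zero (e z)), triv_scal by exact hz; ring.
- generalize (oi z hz); apply filter_imp; exact th.
Qed.

(** [A] and [B] are the partials of [ln N], and [d_z N / N = (A - i B) / 2]. The real part of its
    [d_zbar] is [(A_x + B_y) / 4], a quarter of the Laplacian of [ln N]. *)
Lemma flat_log_harmonic X (L : line_bundle X) (h : bundle_form L)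
  (hf : flat_hermitian_metric h) (i : chart L) :
  let N := fun x y => Re (h (x, y) (frame i (x, y)) (frame i (x, y))) in
  let A := fun x y => Derive (fun t => N t y) x / N x y in
  let B := fun x y => Derive (fun t => N x t) y / N x y in
  forall x y, dom i (x, y) ->
    Derive (fun t => B x t) y = - Derive (fun t => A t y) x.
Proof.
intros N A B x y hz.
generalize (flat_connection_form hf hz).
rewrite (@d_zbar_ext_loc _ (fun w => (/ 2 * A (Re w) (Im w), - / 2 * B (Re w) (Im w)))).
- unfold d_zbar, d_x, d_y; simpl.
  rewrite !Derive_scal.
  intros e; apply (f_equal Re) in e; revert e.
  unfold Cdiv, Cinv, Cmult, Cplus; simpl.
  intros e; change (fun t => B x t) with (B x); field_simplify in e; lra.
- generalize (@dom_open _ _ i _ hz); apply filter_imp; intros w hw.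
  (* Reality of [h (e, e)] is needed in a neighbourhood, since its imaginary part gets
     differentiated. *)
  assert (hI : locally_2d (fun u v => Im (h (u, v) (frame i (u, v)) (frame i (u, v))) = 0)
    (Re w) (Im w)).
  { apply (proj1 (@locally_C_2d w (fun w => Im (h w (frame i w) (frame i w)) = 0))).
    generalize (@dom_open _ _ i _ hw); apply filter_imp; intros v hv.
    rewrite (proj2 (frame_norm_pos (proj1 hf) hv)); reflexivity. }
  assert (hx := locally_2d_1d_const_y _ _ _ hI).
  assert (hy := locally_2d_1d_const_x _ _ _ hI).
  destruct (frame_norm_pos (proj1 hf) hw) as [p q].
  rewrite q; unfold d_z, d_x, d_y.
  assert (dx0 : Derive (fun t => Im (h (t, Im w) (frame i (t, Im w)) (frame i (t, Im w)))) (Re w) = 0).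
  { rewrite (Derive_ext_loc _ (fun _ => 0)) by exact hx; apply Derive_const. }
  assert (dy0 : Derive (fun t => Im (h (Re w, t) (frame i (Re w, t)) (frame i (Re w, t)))) (Im w) = 0).
  { rewrite (Derive_ext_loc _ (fun _ => 0)) by exact hy; apply Derive_const. }
  rewrite dx0, dy0.
  replace (Re (h w (frame i w) (frame i w))) with (N (Re w) (Im w)) in *
    by (destruct w; reflexivity).
  unfold A, B, N in *; revert p; simpl; intros p.
  unfold Cdiv, Cinv, Cmult, Cminus, Copp, Cplus, RtoC; simpl; f_equal; field; lra.
Qed.

Lemma flat_local_unit_section X (L : line_bundle X) (h : bundle_form L)
  (hf : flat_hermitian_metric h) (z0 : C) : X z0 ->
  exists (r : posreal) (s : section L),
    (forall z, Cmod (z - z0)%C < r -> X z) /\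
    unit_section h (fun z => Cmod (z - z0)%C < r) s.
Proof.
intros hX; destruct (dom_cover L hX) as [i hi].
assert (hh := proj1 hf).
generalize (@dom_open _ _ i _ hi); intros hb.
apply locally_C_box in hb; destruct hb as [r hr].
pose (N := fun x y => Re (h (x, y) (frame i (x, y)) (frame i (x, y)))).
pose (A := fun x y => Derive (fun t => N t y) x / N x y).
pose (B := fun x y => Derive (fun t => N x t) y / N x y).
assert (key : forall x y, Rabs (x - Re z0) < r -> Rabs (y - Im z0) < r ->
  (0 < N x y /\ ex_derive (fun t => N t y) x /\ ex_derive (fun t => N x t) y) /\
  (continuity_2d_pt A x y /\ continuity_2d_pt B x y /\
    ex_derive (fun t => A t y) x /\
    continuity_2d_pt (fun u v => Derive (fun t => A t v) u) x y /\
    is_derive (fun t => B x t) y (- Derive (fun t => A t y) x))).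
{ intros x y hx hy.
  assert (hd : dom i (x, y)) by (apply hr; assumption).
  (* Order 2: [A] and [B] contain first derivatives of [N], and the closed form must be
     differentiated once more. *)
  assert (hsm : forall u v, dom i (u, v) -> ex_diff_n N 2 u v).
  { intros u v huv; apply (herm_smooth hh (i := i) 2%nat huv). }
  assert (hp : forall u v, dom i (u, v) -> 0 < N u v).
  { intros u v huv; apply (frame_norm_pos hh huv). }
  assert (hloc : locally_2d (fun u v => dom i (u, v)) x y).
  { apply (proj1 (@locally_C_2d (x, y) (dom i))), (dom_open hd). }
  destruct (hsm x y hd) as (c0 & ex & ey & (cx & exx & _ & (cxx & _) & _) & (cy & _ & eyy & _)).
  assert (h0 := hp x y hd).
  assert (n0 : N x y <> 0) by lra.
  split; [auto|].
  assert (dA : forall u v, dom i (u, v) -> is_derive (fun t => A t v) u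
    ((Derive (fun t => Derive (fun t' => N t' v) t) u * N u v
       - Derive (fun t => N t v) u * Derive (fun t => N t v) u) / N u v ^ 2)).
  { intros u v huv.
    assert (hq := hp u v huv).
    destruct (hsm u v huv) as (_ & k1 & _ & (_ & k2 & _) & _).
    apply (is_derive_div (fun t => Derive (fun t' => N t' v) t) (fun t => N t v));
      [apply Derive_correct, k2 | apply Derive_correct, k1 | lra]. }
  split; [|split; [|split; [|split]]].
  - unfold A, Rdiv; continuity_2d.
  - unfold B, Rdiv; continuity_2d.
  - eexists; apply dA, hd.
  - apply continuity_2d_pt_ext_loc with (fun u v =>
      (Derive (fun t => Derive (fun t' => N t' v) t) u * N u v
       - Derive (fun t => N t v) u * Derive (fun t => N t v) u) * (/ N u v * / N u v)).
    + revert hloc; apply locally_2d_impl, locally_2d_forall; intros u v huv.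
      symmetry; etransitivity; [exact (is_derive_unique _ _ _ (dA u v huv))|].
      field; generalize (hp u v huv); lra.
    + continuity_2d.
  - replace (- Derive (fun t => A t y) x) with (Derive (fun t => B x t) y)
      by exact (flat_log_harmonic hf hd).
    apply Derive_correct.
    apply (@ex_derive_div (fun t => Derive (fun t' => N x t') t) (fun t => N x t));
      assumption. }
destruct (closed_form_exact (fun x y hx hy => proj2 (key x y hx hy))) as [W hW].
(* [W] is a harmonic conjugate of [ln N]: its partials [- B] and [A] complete the Cauchy-Riemann
   system, and [G] has derivative [A - i B]. *)
pose (G := fun w : C => (ln (N (Re w) (Im w)), W (Re w) (Im w)) : C).
assert (box : forall z, Cmod (z - z0)%C < r ->
  Rabs (Re z - Re z0) < r /\ Rabs (Im z - Im z0) < r).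
{ intros z hz; split.
  - eapply Rle_lt_trans; [apply (re_le_Cmod (z - z0)%C) | exact hz].
  - eapply Rle_lt_trans; [apply (im_le_Cmod (z - z0)%C) | exact hz]. }
assert (hdom : forall z, Cmod (z - z0)%C < r -> dom i z).
{ intros z hz; apply hr; apply box, hz. }
assert (hG : forall z, Cmod (z - z0)%C < r -> ex_Cderive G z).
{ intros z hz; destruct (box z hz) as [bx byy].
  apply (@ex_Cderive_of_partials (fun x y => ln (N x y)) W A (fun x y => - B x y)).
  assert (hl : locally_2d (fun u v => Rabs (u - Re z0) < r /\ Rabs (v - Im z0) < r) (Re z) (Im z)).
  { apply locally_2d_and.
    - destruct (locally_abs bx) as [d hd]; exists d; intros u v hu _; apply hd, hu.
    - destruct (locally_abs byy) as [d hd]; exists d; intros u v _ hv; apply hd, hv. }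
  revert hl; apply locally_2d_impl, locally_2d_forall; intros x y [hx hy].
  destruct (key x y hx hy) as ((p & ex & ey) & cA & cB & _).
  destruct (hW x y hx hy) as [w1 w2].
  split_CR.
  - unfold A, Rdiv; apply (is_derive_comp ln (fun t => N t y));
      [apply is_derive_Reals, derivable_pt_lim_ln, p | apply Derive_correct, ex].
  - rewrite Ropp_involutive; unfold B, Rdiv; apply (is_derive_comp ln (fun t => N x t));
      [apply is_derive_Reals, derivable_pt_lim_ln, p | apply Derive_correct, ey].
  - exact w1.
  - exact w2.
  - exact cA.
  - continuity_2d. }
exists r, (fun z => scal (Cexp (RtoC (- / 2) * G z)%C) (frame i z)).
split; [intros z hz; apply (dom_sub (hdom z hz))|].
split.
- apply holomorphic_section_of_chart; intros z hz.
  exists i; split; [apply hdom, hz|].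
  apply ex_Cderive_ext_loc with (fun w => Cexp (RtoC (- / 2) * G w)%C).
  + generalize (dom_open (hdom z hz)); apply filter_imp; intros w hw.
    rewrite triv_scal, triv_frame by exact hw; symmetry; apply Cmult_1_r.
  + apply ex_Cderive_comp; [apply ex_Cderive_Cexp|].
    apply ex_Cderive_mult; [apply ex_derive_const | apply hG, hz].
- intros z hz; assert (hd := hdom z hz); assert (hXz := dom_sub hd).
  rewrite (herm_scal hh hXz), (herm_scal_r hh _ _ _ hXz), Cmult_assoc, <- Cmod2_conj.
  destruct (frame_norm_pos hh hd) as [p q].
  rewrite q, <- RtoC_mult, Cmod_Cexp.
  replace (Re (h z (frame i z) (frame i z))) with (N (Re z) (Im z)) in *
    by (destruct z; reflexivity).
  f_equal; simpl.
  replace (- / 2 * ln (N (Re z) (Im z)) - 0 * W (Re z) (Im z))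
    with (- (ln (N (Re z) (Im z)) / 2)) by field.
  rewrite Rmult_1_r, <- exp_plus.
  replace (- (ln (N (Re z) (Im z)) / 2) + - (ln (N (Re z) (Im z)) / 2))
    with (- ln (N (Re z) (Im z))) by field.
  rewrite exp_Ropp, exp_ln by exact p.
  field; lra.
Qed.

(** * Continuation along segments *)

(** Gluing phrased pointwise: a single-valued relation [P] prescribes the values, so [epsilon] picks
    them without fixing a cover, and near each point the result coincides with a local holomorphic
    section. *)
Lemma glue_sections X (L : line_bundle X) (V : C -> Prop)
  (P : forall z, fiber L z -> Prop) :
  open V -> (forall z, V z -> X z) ->
  (forall z v v', V z -> P z v -> P z v' -> v = v') ->
  (forall z, V z -> exists (U : C -> Prop) (s : section L),
     open U /\ U z /\ holomorphic_section U s /\ forall w, U w -> P w (s w)) ->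
  exists s : section L, holomorphic_section V s /\ forall z, V z -> P z (s z).
Proof.
intros oV sV huniq hloc.
pose (s := (fun z => epsilon (inhabits zero) (P z)) : section L).
assert (hs : forall z, V z -> P z (s z)).
{ intros z hz; apply epsilon_spec.
  destruct (hloc z hz) as (U & t & _ & hU & _ & ht); exists (t z); apply ht, hU. }
exists s; split; [|exact hs].
apply holomorphic_section_of_chart; intros z hz.
destruct (hloc z hz) as (U & t & oU & hU & holt & ht).
destruct (dom_cover L (sV z hz)) as [i hi]; exists i; split; [exact hi|].
apply ex_Cderive_ext_loc with (fun w => triv L i (t w)).
- generalize (filter_and _ _ (oV z hz) (oU z hU)); apply filter_imp.
  intros w [wV wU]; f_equal; apply (huniq w); auto.
- apply holt; split; assumption.
Qed.

Lemma open_Cmod_ball (p : C) (r : R) : open (fun w => Cmod (w - p)%C < r).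
Proof.
intros z hz; apply locally_C_box.
assert (hp : 0 < (r - Cmod (z - p)%C) / 2) by lra.
exists (mkposreal _ hp); simpl; intros w h1 h2.
replace (w - p)%C with ((w - z) + (z - p))%C by ring.
eapply Rle_lt_trans; [apply Cmod_triangle|].
generalize (Cmod_le_abs (w - z)%C).
change (Re (w - z)%C) with (Re w - Re z); change (Im (w - z)%C) with (Im w - Im z).
lra.
Qed.

Lemma Cmod_convex (u v : C) (t r : R) : 0 <= t <= 1 ->
  Cmod u < r -> Cmod v < r -> Cmod (u + t * (v - u))%C < r.
Proof.
intros ht hu hv.
replace (u + t * (v - u))%C with (RtoC (1 - t) * u + RtoC t * v)%C
  by (rewrite RtoC_minus; ring).
eapply Rle_lt_trans; [apply Cmod_triangle|].
rewrite !Cmod_mult, !Cmod_R, !Rabs_pos_eq by lra.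
destruct (Req_dec t 0) as [->|h0]; [lra|].
assert (0 < t) by lra; nra.
Qed.

Lemma convex_Cmod_ball (p : C) (r : R) : convex (fun w => Cmod (w - p)%C < r).
Proof.
intros z w t hz hw ht.
replace (z + t * (w - z) - p)%C with ((z - p) + t * ((w - p) - (z - p)))%C by ring.
apply Cmod_convex; assumption.
Qed.

Lemma convex_inter (V W : C -> Prop) :
  convex V -> convex W -> convex (fun z => V z /\ W z).
Proof. intros hV hW z w t [z1 z2] [w1 w2] ht; split; auto. Qed.

(** The sum of a segment and a disc, hence open and convex, so that unit sections can be compared on
    it and on its intersection with a disc. *)
Definition tube (p d : C) (a eps : R) (w : C) : Prop :=
  exists t : R, 0 <= t <= a /\ Cmod (w - (p + t * d))%C < eps.

Lemma open_tube (p d : C) (a eps : R) : open (tube p d a eps).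
Proof.
intros z (t & ht & hz).
generalize (open_Cmod_ball hz); apply filter_imp; intros w hw.
exists t; split; assumption.
Qed.

Lemma convex_tube (p d : C) (a eps : R) : convex (tube p d a eps).
Proof.
intros z w l (t & ht & hz) (u & hu & hw) hl.
exists (t + l * (u - t)); split; [nra|].
replace (z + l * (w - z) - (p + RtoC (t + l * (u - t)) * d))%C
  with ((z - (p + t * d)) + l * ((w - (p + u * d)) - (z - (p + t * d))))%C
  by (rewrite RtoC_plus, RtoC_mult, RtoC_minus; ring).
apply Cmod_convex; assumption.
Qed.

Lemma tube_point (p d : C) (a eps t : R) :
  0 < eps -> 0 <= t <= a -> tube p d a eps (p + t * d)%C.
Proof.
intros he ht; exists t; split; [exact ht|].
replace (p + t * d - (p + t * d))%C with (RtoC 0) by ring.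
rewrite Cmod_0; exact he.
Qed.

Lemma tube_start (p d : C) (a eps : R) : 0 < eps -> 0 <= a -> tube p d a eps p.
Proof.
intros he ha; replace p with (p + RtoC 0 * d)%C at 2 by ring.
apply tube_point; lra.
Qed.

Lemma unit_section_union X (L : line_bundle X) (h : bundle_form L)
  (V W : C -> Prop) (s t : section L) :
  open V -> open W -> (forall z, V z -> X z) -> (forall z, W z -> X z) ->
  unit_section h V s -> unit_section h W t ->
  (forall z, V z -> W z -> s z = t z) ->
  exists u : section L, unit_section h (fun z => V z \/ W z) u.
Proof.
intros oV oW sV sW [hs s1] [ht t1] e.
destruct (@glue_sections X L (fun z => V z \/ W z)
  (fun z v => (V z /\ v = s z) \/ (W z /\ v = t z))) as (u & hu & pu).
- apply open_or; assumption.
- intros z [hz|hz]; auto.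
- intros z v v' _ [[h1 ->]|[h1 ->]] [[h2 ->]|[h2 ->]]; auto.
  symmetry; auto.
- intros z [hz|hz]; [exists V, s | exists W, t]; auto 6.
- exists u; split; [exact hu|].
  intros z hz; destruct (pu z hz) as [[k ->]|[k ->]]; auto.
Qed.

(** Supremum argument: let [m] be the supremum of the lengths [a] reached by a unit section. A local
    section at [p + m d], rotated by a constant to match, extends one that ends shortly before [m];
    passing beyond [m] is impossible, so the extension reaches 1. *)
Lemma segment_unit_section X (L : line_bundle X) (h : bundle_form L)
  (hf : flat_hermitian_metric h) (p d : C) :
  (forall t : R, 0 <= t <= 1 -> X (p + t * d)%C) ->
  exists (eps : posreal) (s : section L),
    (forall z, tube p d 1 eps z -> X z) /\ unit_section h (tube p d 1 eps) s.
Proof.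
intros hX.
assert (hh := proj1 hf).
pose (E := fun a : R => 0 <= a <= 1 /\ exists (eps : posreal) (s : section L),
  (forall z, tube p d a eps z -> X z) /\ unit_section h (tube p d a eps) s).
assert (E0 : E 0).
{ split; [lra|].
  destruct (flat_local_unit_section hf (hX 0 ltac:(lra))) as (r & s & hr & hs).
  assert (ht : forall z, tube p d 0 r z -> Cmod (z - (p + RtoC 0 * d))%C < r).
  { intros z (t & ht & hz); replace t with 0 in hz by lra; exact hz. }
  exists r, s; split; [intros z hz; apply hr, ht, hz|].
  apply unit_section_subset with (2 := hs); exact ht. }
destruct (completeness E) as [m [hub hlub]].
{ exists 1; intros a [ha _]; lra. }
{ exists 0; exact E0. }
assert (hm : 0 <= m <= 1).
{ split; [apply hub, E0 | apply hlub; intros a [ha _]; lra]. }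
destruct (flat_local_unit_section hf (hX m hm)) as (r & tau & hr & htau).
set (q := (p + m * d)%C) in *.
assert (hr0 := cond_pos r).
assert (hd0 := Cmod_ge_0 d).
(* Parameters within [delta] of [m] give points within [r / 2] of [q]; with a tube of width at most
   [r / 2], everything past [a] lies in the ball of radius [r]. *)
set (delta := r / 2 / (Cmod d + 1)).
assert (hdelta : 0 < delta) by (unfold delta; apply Rdiv_lt_0_compat; lra).
assert (hdd : delta * (Cmod d + 1) = r / 2) by (unfold delta; field; lra).
assert (near : forall t : R, Rabs (t - m) <= delta ->
  Cmod (p + t * d - q)%C < r / 2).
{ intros t ht; unfold q.
  replace (p + t * d - (p + m * d))%C with (RtoC (t - m) * d)%C
    by (rewrite RtoC_minus; ring).
  rewrite Cmod_mult, Cmod_R.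
  generalize (Rabs_pos (t - m)); nra. }
assert (ha : exists a, E a /\ m - delta < a).
{ apply NNPP; intros hn.
  assert (m <= m - delta); [|lra].
  apply hlub; intros a ha; apply Rnot_lt_le; intros k; apply hn; exists a; auto. }
destruct ha as (a & (ha01 & eps & s & hsX & hs) & ham).
assert (ham' : a <= m) by (apply hub; split; [exact ha01 | exists eps, s; auto]).
set (ball := fun z => Cmod (z - q)%C < r) in *.
assert (oB : open ball) by apply open_Cmod_ball.
destruct (@unit_section_unique X L h hh (fun z => tube p d a eps z /\ ball z) tau s)
  as (c & hc & hsc).
{ apply open_and; [apply open_tube | exact oB]. }
{ apply convex_inter; [apply convex_tube | apply convex_Cmod_ball]. }
{ intros z [hz _]; auto. }
{ apply unit_section_subset with (2 := htau); intros z [_ hz]; exact hz. }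
{ apply unit_section_subset with (2 := hs); intros z [hz _]; exact hz. }
destruct (@unit_section_union X L h (tube p d a eps) ball s (fun z => scal c (tau z)))
  as (u & hu).
{ apply open_tube. }
{ exact oB. }
{ exact hsX. }
{ exact hr. }
{ exact hs. }
{ apply (unit_section_scal hh hr hc htau). }
{ intros z h1 h2; apply hsc; split; assumption. }
set (b := Rmin 1 (m + delta)).
assert (hb : a <= b <= 1 /\ b <= m + delta).
{ unfold b; split; [split|]; [apply Rmin_glb; lra | apply Rmin_l | apply Rmin_r]. }
assert (heps := cond_pos eps).
assert (he' : 0 < Rmin eps (r / 2)) by (apply Rmin_glb_lt; lra).
assert (hsub : forall z, tube p d b (Rmin eps (r / 2)) z -> tube p d a eps z \/ ball z).
{ intros z (t & ht & hz).
  generalize (Rmin_l eps (r / 2)) (Rmin_r eps (r / 2)); intros m1 m2.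
  destruct (Rle_dec t a) as [hta|hta].
  - left; exists t; split; lra.
  - right; unfold ball.
    replace (z - q)%C with ((z - (p + t * d)) + (p + t * d - q))%C by ring.
    eapply Rle_lt_trans; [apply Cmod_triangle|].
    assert (Rabs (t - m) <= delta) by (apply Rabs_le; lra).
    generalize (near t H); lra. }
assert (Eb : E b).
{ split; [lra|].
  exists (mkposreal _ he'), u; split.
  - intros z hz; destruct (hsub z hz); auto.
  - apply unit_section_subset with (2 := hu); exact hsub. }
assert (b1 : b = 1).
{ generalize (hub b Eb); unfold b, Rmin; destruct (Rle_dec 1 (m + delta)); lra. }
rewrite b1 in Eb; apply Eb.
Qed.

Lemma tube_min (p d : C) (a e e' : R) (z : C) :
  tube p d a (Rmin e e') z -> tube p d a e z /\ tube p d a e' z.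
Proof.
intros (t & ht & hz); generalize (Rmin_l e e') (Rmin_r e e'); intros.
split; exists t; split; lra.
Qed.

(* Flat continuation along the segments issued from a base point [p]. *)
Lemma convex_unit_section X (L : line_bundle X) (h : bundle_form L)
  (hf : flat_hermitian_metric h) (V : C -> Prop) (p : C) :
  open V -> convex V -> (forall z, V z -> X z) -> V p ->
  exists s : section L, unit_section h V s.
Proof.
intros oV cV sV hp.
assert (hh := proj1 hf).
destruct (flat_local_unit_section hf (sV p hp)) as (r & s0 & _ & _ & hs0).
assert (e1 : h p (s0 p) (s0 p) = RtoC 1).
{ apply hs0; replace (p - p)%C with (RtoC 0) by ring; rewrite Cmod_0; apply cond_pos. }
(* The continued value at [z]. The normalization [s p = s0 p] makes it unique: two candidates agree
   on the thinner of their tubes. *)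
pose (P := fun z (v : fiber L z) => exists (eps : posreal) (s : section L),
  (forall w, tube p (z - p)%C 1 eps w -> X w) /\
  unit_section h (tube p (z - p)%C 1 eps) s /\ s p = s0 p /\ v = s z).
assert (zend : forall z (eps : R), 0 < eps -> tube p (z - p)%C 1 eps z).
{ intros z eps he; replace z with (p + RtoC 1 * (z - p))%C at 2 by ring.
  apply tube_point; lra. }
destruct (@glue_sections X L V P) as (s & hs & ps).
- exact oV.
- exact sV.
- intros z v v' hz (eps & s & hsX & hs & sp & ->) (eps' & s' & _ & hs' & sp' & ->).
  assert (he : 0 < Rmin eps eps') by (apply Rmin_glb_lt; apply cond_pos).
  apply (@unit_section_eq X L h hh (tube p (z - p)%C 1 (Rmin eps eps')) s s' p).
  + apply open_tube.
  + apply convex_tube.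
  + intros w hw; apply hsX, (tube_min hw).
  + apply unit_section_subset with (2 := hs); intros w hw; apply (tube_min hw).
  + apply unit_section_subset with (2 := hs'); intros w hw; apply (tube_min hw).
  + apply tube_start; lra.
  + congruence.
  + apply zend; exact he.
- intros z hz.
  destruct (@segment_unit_section X L h hf p (z - p)%C) as (eps & s & hsX & hs).
  { intros t ht; apply sV, cV; assumption. }
  assert (he := cond_pos eps).
  assert (tp : tube p (z - p)%C 1 eps p) by (apply tube_start; lra).
  assert (n1 : h p (s p) (s p) = RtoC 1) by (apply hs, tp).
  set (c := h p (s0 p) (s p)).
  assert (sc : s0 p = scal c (s p)).
  { assert (n0 : h p (s p) (s p) <> RtoC 0) by (rewrite n1; apply RtoC_1_neq_0).
    rewrite (herm_coord hh (s0 p) (sV p hp) n0) at 1; rewrite n1; unfold c.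
    f_equal; field. }
  assert (hc : Cmod c = 1).
  { rewrite sc, (herm_scal hh (sV p hp)), (herm_scal_r hh _ _ _ (sV p hp)), n1, Cmult_1_r,
      <- Cmod2_conj in e1.
    apply RtoC_inj in e1; generalize (Cmod_ge_0 c); intros; nra. }
  exists (fun w => Cmod (w - z)%C < eps), (fun w => scal c (s w)).
  assert (hu : unit_section h (tube p (z - p)%C 1 eps) (fun w => scal c (s w)))
    by apply (unit_section_scal hh hsX hc hs).
  split; [apply open_Cmod_ball|]; split; [|split].
  + replace (z - z)%C with (RtoC 0) by ring; rewrite Cmod_0; exact he.
  + apply holomorphic_section_subset with (2 := proj1 hu).
    intros w hw; exists 1; split; [lra|].
    replace (w - (p + RtoC 1 * (z - p)))%C with (w - z)%C by ring; exact hw.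
  + intros w hw.
    assert (hp' : 0 < eps - Cmod (w - z)%C) by lra.
    (* Points with the same parameter on the segments to [w] and to [z] are at most [|w - z|] apart.
       So the section along the segment to [z] also gives the continued values at all nearby [w]. *)
    assert (hsub : forall v, tube p (w - p)%C 1 (eps - Cmod (w - z)%C) v ->
      tube p (z - p)%C 1 eps v).
    { intros v (t & ht & hv); exists t; split; [exact ht|].
      replace (v - (p + t * (z - p)))%C
        with ((v - (p + t * (w - p))) + RtoC t * (w - z))%C by ring.
      eapply Rle_lt_trans; [apply Cmod_triangle|].
      rewrite Cmod_mult, Cmod_R, Rabs_pos_eq by lra.
      generalize (Cmod_ge_0 (w - z)%C); nra. }
    exists (mkposreal _ hp'), (fun w => scal c (s w)); split; [|split; [|split]].
    * intros v hv; apply hsX, hsub, hv.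
    * apply unit_section_subset with (2 := hu); exact hsub.
    * symmetry; exact sc.
    * reflexivity.
- exists s; split; [exact hs|].
  intros z hz; destruct (ps z hz) as (eps & t & _ & ht & _ & ->).
  apply ht, zend, cond_pos.
Qed.

(** * Monodromy around the origin *)

Lemma unimodular_Cexp (mu : C) :
  Cmod mu = 1 -> exists t : R, mu = Cexp (0, t).
Proof.
intros h; generalize (Cmod1_sqr h); destruct mu as [p q]; simpl; intros e.
assert (hp : -1 <= p <= 1) by nra.
unfold Cexp; simpl; rewrite exp_0.
assert (hs : sin (acos p) = Rabs q).
{ rewrite sin_acos by exact hp; rewrite <- sqrt_Rsqr_abs; f_equal; unfold Rsqr; lra. }
destruct (Rle_dec 0 q) as [hq|hq].
- exists (acos p); rewrite cos_acos by exact hp.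
  rewrite hs, Rabs_pos_eq by exact hq; f_equal; ring.
- exists (- acos p); rewrite cos_neg, sin_neg, cos_acos by exact hp.
  rewrite hs, Rabs_left by lra; f_equal; ring.
Qed.

(** The half disc around the ray of [i^k]. The index is not reduced modulo 4: [half_disc 4] is the
    same set as [half_disc 0], but reached after a full turn. *)
Definition half_disc (k : nat) (z : C) : Prop :=
  Cmod z < 1 /\ 0 < Re (z * (- Ci) ^ k)%C.

Lemma open_half_disc (k : nat) : open (half_disc k).
Proof.
apply open_and.
- intros z hz.
  assert (hz' : Cmod (z - RtoC 0)%C < 1) by (unfold Cminus; rewrite Copp_0, Cplus_0_r; exact hz).
  generalize (open_Cmod_ball hz'); apply filter_imp; intros w.
  unfold Cminus; rewrite Copp_0, Cplus_0_r; auto.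
- intros z hz; set (x := Re (z * (- Ci) ^ k)%C) in *.
  generalize (@open_Cmod_ball z x z); intros hb.
  replace (z - z)%C with (RtoC 0) in hb by ring; rewrite Cmod_0 in hb.
  generalize (hb hz); apply filter_imp; intros w hw.
  replace (w * (- Ci) ^ k)%C with (z * (- Ci) ^ k + (w - z) * (- Ci) ^ k)%C by ring.
  generalize (re_le_Cmod ((w - z) * (- Ci) ^ k)%C).
  rewrite Cmod_mult, Cmod_pow, Cmod_opp, Cmod_Ci, pow1, Rmult_1_r; intros hr.
  change (0 < x + Re ((w - z) * (- Ci) ^ k)%C).
  generalize (Rabs_def2 _ _ (Rle_lt_trans _ _ _ hr hw)); lra.
Qed.

Lemma convex_half_disc (k : nat) : convex (half_disc k).
Proof.
intros z w t [z1 z2] [w1 w2] ht; split; [apply Cmod_convex; assumption|].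
replace ((z + t * (w - z)) * (- Ci) ^ k)%C
  with (z * (- Ci) ^ k + t * (w * (- Ci) ^ k - z * (- Ci) ^ k))%C by ring.
revert z2 w2; generalize (z * (- Ci) ^ k)%C (w * (- Ci) ^ k)%C.
intros [a b] [c d]; simpl; intros; destruct (Req_dec t 0) as [->|h0]; [lra|].
assert (0 < t) by lra; nra.
Qed.

Lemma half_disc_punctured (k : nat) (z : C) : half_disc k z -> punctured_disc z.
Proof.
intros [h1 h2]; split; [|exact h1].
apply Cmod_gt_0; intros ->; rewrite Cmult_0_l in h2; simpl in h2; lra.
Qed.

Lemma half_disc_nonempty (k : nat) : half_disc k (RtoC (/ 2) * Ci ^ k)%C.
Proof.
split.
- rewrite Cmod_mult, Cmod_pow, Cmod_Ci, pow1, Cmod_R, Rabs_pos_eq; lra.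
- rewrite <- Cmult_assoc, <- Cpow_mult_l.
  replace (Ci * - Ci)%C with (RtoC 1)
    by (unfold Ci, Copp, Cmult, RtoC; simpl; f_equal; ring).
  rewrite Cpow_1_l; simpl; lra.
Qed.

(** The hypotheses place [z = x + i y] in the open first quadrant, where
    [atan (y / x) = PI / 2 - atan (x / y)]. *)
Lemma Clog_quarter_turn (z : C) : 0 < Re z -> 0 < Re (z * - Ci)%C ->
  (Clog (z * - Ci) + (0, PI / 2)%R)%C = Clog z.
Proof.
destruct z as [x y]; unfold Clog, Cplus; simpl; intros hx hy.
replace (x * - 0 - y * - (1)) with y in * by ring.
replace (x * - (1) + y * - 0) with (- x) by ring.
f_equal.
- rewrite Rplus_0_r; do 2 f_equal; ring.
- assert (0 < x / y) by (apply Rdiv_lt_0_compat; lra).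
  replace (y / x) with (/ (x / y)) by (field; lra).
  rewrite atan_inv by assumption.
  replace (- x / y) with (- (x / y)) by (field; lra).
  rewrite atan_opp; ring.
Qed.

(* The branch of [z^a] on [half_disc k] whose argument is near [k PI / 2]. *)
Definition power_branch (a : R) (k : nat) (z : C) : C :=
  Cexp (RtoC a * (Clog (z * (- Ci) ^ k) + (0, INR k * (PI / 2))%R))%C.

Lemma power_branch_holomorphic (a : R) (k : nat) :
  holomorphic_on (half_disc k) (power_branch a k).
Proof.
intros z [_ hz].
apply (@ex_Cderive_comp Cexp
  (fun w => RtoC a * (Clog (w * (- Ci) ^ k) + (0, INR k * (PI / 2))%R))%C);
  [apply ex_Cderive_Cexp|].
apply ex_Cderive_mult; [apply ex_derive_const|].
apply (@ex_derive_plus C_AbsRing C_NormedModule); [|apply ex_derive_const].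
apply (@ex_Cderive_comp Clog (fun w => w * (- Ci) ^ k)%C);
  [apply ex_Cderive_Clog, hz|].
apply (@ex_Cderive_mult (fun w => w) (fun _ => (- Ci) ^ k)%C); [|apply ex_derive_const].
eexists; apply is_Cderive_absring, is_derive_id.
Qed.

Lemma power_branch_Cmod (a : R) (k : nat) (z : C) : half_disc k z ->
  Cmod (power_branch a k z) = Rpower (Cmod z) a.
Proof.
intros hz; unfold power_branch, Rpower; rewrite Cmod_Cexp; f_equal.
assert (hm : Cmod (z * (- Ci) ^ k)%C = Cmod z)
  by (rewrite Cmod_mult, Cmod_pow, Cmod_opp, Cmod_Ci, pow1; ring).
assert (h0 : 0 < Cmod z) by apply (half_disc_punctured hz).
generalize (Cmod2_alt (z * (- Ci) ^ k)%C); rewrite hm; intros e.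
unfold Clog.
replace (Re (z * (- Ci) ^ k)%C * Re (z * (- Ci) ^ k)%C
  + Im (z * (- Ci) ^ k)%C * Im (z * (- Ci) ^ k)%C) with (Cmod z ^ 2)
  by (rewrite e; ring).
replace (Cmod z ^ 2) with (Cmod z * Cmod z) by ring.
rewrite ln_mult by exact h0.
simpl; field.
Qed.

Lemma power_branch_S (a : R) (k : nat) (z : C) :
  half_disc k z -> half_disc (S k) z -> power_branch a (S k) z = power_branch a k z.
Proof.
intros [_ h1] [_ h2]; unfold power_branch; do 2 f_equal.
rewrite Cpow_S in h2 |- *.
replace (z * (- Ci * (- Ci) ^ k))%C with (z * (- Ci) ^ k * - Ci)%C in * by ring.
rewrite <- (Clog_quarter_turn h1 h2), <- Cplus_assoc; f_equal.
unfold Cplus; rewrite S_INR; simpl; f_equal; ring.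
Qed.

Lemma quarter_turn_4 : ((- Ci) ^ 4 = 1)%C.
Proof. unfold Ci, Copp, RtoC; simpl; unfold Cmult; simpl; f_equal; ring. Qed.

Lemma half_disc_4 (z : C) : half_disc 4 z <-> half_disc 0 z.
Proof. unfold half_disc; rewrite quarter_turn_4; simpl; tauto. Qed.

(** Four offsets of [PI / 2] make a full turn; the factor is the monodromy of [z^a]. *)
Lemma power_branch_4 (a : R) (z : C) :
  power_branch a 4 z = (Cexp (0, a * (2 * PI))%R * power_branch a 0 z)%C.
Proof.
unfold power_branch; rewrite quarter_turn_4, <- Cexp_plus; f_equal.
change ((- Ci) ^ 0)%C with (RtoC 1).
generalize (Clog (z * 1)%C); intros [p q].
unfold Cplus, Cmult, RtoC; simpl; f_equal; field.
Qed.

Lemma punctured_disc_cover (z : C) : punctured_disc z ->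
  half_disc 0 z \/ half_disc 1 z \/ half_disc 2 z \/ half_disc 3 z.
Proof.
intros [h0 h1]; unfold half_disc.
destruct z as [x y].
assert (hn : x <> 0 \/ y <> 0).
{ destruct (Req_dec x 0) as [->|]; [|auto].
  destruct (Req_dec y 0) as [->|]; [|auto].
  exfalso; change (0, 0) with (RtoC 0) in h0; rewrite Cmod_0 in h0; lra. }
simpl; unfold Re, Im in *; simpl.
destruct (Rlt_dec 0 x); [left; split; [exact h1 | lra]|].
destruct (Rlt_dec 0 y); [right; left; split; [exact h1 | lra]|].
destruct (Rlt_dec x 0); [right; right; left; split; [exact h1 | lra]|].
right; right; right; split; [exact h1 | lra].
Qed.

(** [(- i)^2 = - 1] reverses the sign of the real part. When gluing, only cyclically consecutive
    half discs remain to be compared. *)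
Lemma half_disc_opposite (k : nat) (z : C) :
  half_disc k z -> half_disc (S (S k)) z -> False.
Proof.
intros [_ h1] [_ h2]; rewrite !Cpow_S in h2.
replace (z * (- Ci * (- Ci * (- Ci) ^ k)))%C with (- (z * (- Ci) ^ k))%C in h2.
- revert h1 h2; generalize (z * (- Ci) ^ k)%C; intros [p q]; simpl; lra.
- generalize ((- Ci) ^ k)%C; destruct z as [x y]; intros [p q].
  unfold Ci, Copp, Cmult; simpl; f_equal; ring.
Qed.

Lemma half_disc_unit_section (L : line_bundle punctured_disc) (h : bundle_form L)
  (hf : flat_hermitian_metric h) (k : nat) :
  exists s : section L, unit_section h (half_disc k) s.
Proof.
apply (convex_unit_section hf (@open_half_disc k) (@convex_half_disc k)
  (@half_disc_punctured k) (half_disc_nonempty k)).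
Qed.

Lemma half_disc_continuation (L : line_bundle punctured_disc) (h : bundle_form L)
  (hf : flat_hermitian_metric h) (k : nat) (s : section L) :
  unit_section h (half_disc k) s ->
  exists t : section L, unit_section h (half_disc (S k)) t /\
    forall z, half_disc k z -> half_disc (S k) z -> t z = s z.
Proof.
intros hs.
destruct (half_disc_unit_section hf (S k)) as [t ht].
destruct (@unit_section_unique _ L h (proj1 hf)
  (fun z => half_disc k z /\ half_disc (S k) z) t s) as (c & hc & e).
- apply open_and; apply open_half_disc.
- apply convex_inter; apply convex_half_disc.
- intros z [hz _]; apply half_disc_punctured with k, hz.
- apply unit_section_subset with (2 := ht); intros z [_ hz]; exact hz.
- apply unit_section_subset with (2 := hs); intros z [hz _]; exact hz.
- exists (fun z => scal c (t z)); split.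
  + apply (unit_section_scal (proj1 hf) (@half_disc_punctured (S k)) hc ht).
  + intros z h1 h2; symmetry; apply e; split; assumption.
Qed.

(* Continuing a unit section once around the origin multiplies it by some
   [mu = exp (i t)]; the factor [z^a] with [2 PI a = - t] compensates. *)
Lemma flat_global_section (L : line_bundle punctured_disc) (h : bundle_form L)
  (hf : flat_hermitian_metric h) :
  exists (a : R) (S : section L), holomorphic_section punctured_disc S /\
    forall z, punctured_disc z -> h z (S z) (S z) = RtoC (Rpower (Cmod z) (2 * a)).
Proof.
assert (hh := proj1 hf).
destruct (half_disc_unit_section hf 0) as [s0 h0].
destruct (half_disc_continuation hf h0) as (s1 & h1 & e1).
destruct (half_disc_continuation hf h1) as (s2 & h2 & e2).
destruct (half_disc_continuation hf h2) as (s3 & h3 & e3).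
destruct (half_disc_continuation hf h3) as (s4 & h4 & e4).
destruct (unit_section_unique hh (@open_half_disc 0) (@convex_half_disc 0)
  (@half_disc_punctured 0) h0 (unit_section_subset (fun z => proj2 (half_disc_4 z)) h4))
  as (mu & hmu & emu).
destruct (unimodular_Cexp hmu) as [t ht].
set (a := - t / (2 * PI)).
assert (hpi := PI_RGT_0).
pose (T := fun k (s : section L) => (fun z => scal (power_branch a k z) (s z)) : section L).
assert (hT : forall k (s : section L) z, unit_section h (half_disc k) s -> half_disc k z ->
  h z (T k s z) (T k s z) = RtoC (Rpower (Cmod z) (2 * a))).
{ intros k s z hs hz; assert (hX := half_disc_punctured hz); unfold T.
  rewrite (herm_scal hh hX), (herm_scal_r hh _ _ _ hX), (proj2 hs) by exact hz.
  rewrite Cmult_1_r, <- Cmod2_conj, power_branch_Cmod by exact hz.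
  f_equal; simpl; rewrite Rmult_1_r, <- Rpower_plus; f_equal; ring. }
assert (holT : forall k (s : section L), unit_section h (half_disc k) s ->
  holomorphic_section (half_disc k) (T k s)).
{ intros k s hs; apply holomorphic_section_scal; [apply power_branch_holomorphic | apply hs]. }
assert (step : forall k (s s' : section L),
  (forall z, half_disc k z -> half_disc (S k) z -> s' z = s z) ->
  forall z, half_disc k z -> half_disc (S k) z -> T k s z = T (S k) s' z).
{ intros k s s' e z z1 z2; unfold T; rewrite e, power_branch_S by assumption; reflexivity. }
assert (E1 := step _ _ _ e1); assert (E2 := step _ _ _ e2); assert (E3 := step _ _ _ e3).
assert (E4 : forall z, half_disc 3 z -> half_disc 0 z -> T 3%nat s3 z = T 0%nat s0 z).
(* The closing overlap: pass to the fourth continuation, whose section is [mu * s0] and whose branch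
   is [exp (2 PI i a)] times the initial one. The choice of [a] makes the product of these factors
   1. *)
{ intros z z3 z0; rewrite (step _ _ _ e4 z z3) by (apply half_disc_4, z0).
  unfold T; rewrite power_branch_4, emu, scal_C_assoc by exact z0; f_equal.
  replace (Cexp (0, a * (2 * PI))%R * power_branch a 0 z * mu)%C
    with (mu * Cexp (0, a * (2 * PI))%R * power_branch a 0 z)%C by ring.
  rewrite ht, <- Cexp_plus.
  replace ((0, t) + (0, a * (2 * PI))%R)%C with (RtoC 0)
    by (unfold Cplus, RtoC, a; simpl; f_equal; field; lra).
  unfold Cexp at 1; simpl; rewrite exp_0, cos_0, sin_0.
  replace (1 * 1, 1 * 0) with (RtoC 1) by (unfold RtoC; f_equal; ring).
  ring. }
destruct (@glue_sections _ L punctured_disc (fun z v =>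
  (half_disc 0 z /\ v = T 0%nat s0 z) \/ (half_disc 1 z /\ v = T 1%nat s1 z) \/
  (half_disc 2 z /\ v = T 2%nat s2 z) \/ (half_disc 3 z /\ v = T 3%nat s3 z)))
  as (s & hs & ps).
- apply punctured_disc_open.
- auto.
- intros z v v' _.
  (* Sixteen cases: equal indices, opposite half discs, and neighbours in either order, settled by
     [E1] to [E4]. *)
  intros [[z1 ->]|[[z1 ->]|[[z1 ->]|[z1 ->]]]] [[z2 ->]|[[z2 ->]|[[z2 ->]|[z2 ->]]]];
    first [ reflexivity
          | destruct (half_disc_opposite z1 z2)
          | destruct (half_disc_opposite z2 z1)
          | auto; fail
          | symmetry; auto; fail ].
- intros z hz; destruct (punctured_disc_cover hz) as [k|[k|[k|k]]].
  + exists (half_disc 0), (T 0%nat s0); split; [apply open_half_disc|]; auto 10.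
  + exists (half_disc 1), (T 1%nat s1); split; [apply open_half_disc|]; auto 10.
  + exists (half_disc 2), (T 2%nat s2); split; [apply open_half_disc|]; auto 10.
  + exists (half_disc 3), (T 3%nat s3); split; [apply open_half_disc|]; auto 10.
- exists a, s; split; [exact hs|].
  intros z hz; destruct (ps z hz) as [[k ->]|[[k ->]|[[k ->]|[k ->]]]]; auto.
Qed.

(** * The isometry with the model metric *)

Unset Implicit Arguments.
Set Strict Implicit.

Theorem corollary1p8 (L : line_bundle punctured_disc) (h : bundle_form L)
  (hh : flat_hermitian_metric h) :
  exists c : R, isometric_isomorphic h (model_metric c).
Proof.
assert (hm := proj1 hh).
destruct (flat_global_section hh) as (a & S & hS & normS).
assert (n0 : forall z, punctured_disc z -> h z (S z) (S z) <> RtoC 0).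
{ intros z hz; rewrite normS by exact hz; intros e; apply RtoC_inj in e.
  generalize (exp_pos (2 * a * ln (Cmod z))); unfold Rpower in e; lra. }
(* The coordinate along the global frame [S], expressed by [h] so that it involves no chart; in a
   chart, [herm_ratio] turns its value on [frame i] into [1 / triv L i (S w)], which is
   holomorphic. *)
exists (- a), (fun z u => (h z u (S z) / h z (S z) (S z))%C),
  (fun z (v : C) => scal v (S z) : fiber L z).
split; [|split; [|split; [|split]]].
- split.
  + intros z hz; split.
    * intros u v; rewrite (herm_plus hm hz); unfold Cdiv; apply Cmult_plus_distr_r.
    * intros c v; rewrite (herm_scal hm hz); unfold Cdiv; symmetry; apply Cmult_assoc.
  + intros i j z [hi hz].
    apply ex_Cderive_ext_loc with (fun w => (1 / triv L i (S w))%C).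
    * generalize (filter_and _ _ (dom_open hi) (punctured_disc_open hz)).
      apply filter_imp; intros w [wi wX]; simpl.
      rewrite (herm_ratio hm (frame i w) wX wi (n0 w wX)), triv_frame by exact wi.
      reflexivity.
    * apply ex_Cderive_div; [|apply ex_derive_const|apply hS; split; assumption].
      apply (herm_neq0_triv hm hz hi (n0 z hz)).
- split.
  + intros z hz; split.
    * intros u v; apply (@scal_distr_r C_Ring).
    * intros c v; symmetry; apply (scal_C_assoc (V := fiber L z)).
  + intros j i z [hz hi].
    apply ex_Cderive_ext_loc with (fun w => triv L i (S w)).
    * apply filter_forall; intros w; f_equal; symmetry; apply scal_C_one.
    * apply hS; split; assumption.
- intros z hz u; symmetry; apply (herm_coord hm u hz (n0 z hz)).
- intros z hz v.
  change ((h z (scal v (S z)) (S z) / h z (S z) (S z))%C = v :> C).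
  rewrite (herm_scal hm hz); field; apply n0, hz.
- intros z hz u v; unfold model_metric.
  set (x := (h z u (S z) / h z (S z) (S z))%C).
  set (y := (h z v (S z) / h z (S z) (S z))%C).
  rewrite (herm_coord hm u hz (n0 z hz)), (herm_coord hm v hz (n0 z hz)).
  fold x y.
  rewrite (herm_scal hm hz), (herm_scal_r hm _ _ _ hz), normS by exact hz.
  replace (2 * - a) with (- (2 * a)) by ring.
  rewrite Rpower_Ropp, RtoC_inv by (unfold Rpower; apply Rgt_not_eq, exp_pos).
  field; rewrite <- normS by exact hz; apply n0, hz.
Qed.
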